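(* Let $\{\lambda_n\}_{n=0}^\infty$ be the eigenvalues of the non-local boundary value problem $$-\phi''=\lambda\phi \ \text{ on } (0,1),\qquad \phi(0)+\phi(1)=-\phi'(0)=\phi'(1),$$ and let $K(x,y)=-|x-y|/2$ for $x,y\in[0,1]$. Then $$\sum_{n=0}^\infty\frac{1}{\lambda_n}=\int_0^1K(x,x)\,dx=0.$$
   Context: The eigenvalues $\{\lambda_n\}_{n\ge 0}$ are explicitly the following (each listed once): $\lambda_0<0$ is the only negative eigenvalue ($\lambda_0\approx-5.756915$) and is the solution of $\coth\frac{\sqrt{-\lambda_0}}{2}=\frac{\sqrt{-\lambda_0}}{2}$; $\lambda_{2m-1}=(2m-1)^2\pi^2$ for $m=1,2,\ldots$; and, for $m=1,2,\ldots$, $\lambda_{2m}>0$ is the $m$-th positive solution of $\cot\frac{\sqrt{\lambda_{2m}}}{2}=-\frac{\sqrt{\lambda_{2m}}}{2}$. The corresponding eigenfunctions are those of the integral operator on $L^2(0,1)$ with kernel $K(x,y)$, whose eigenvalues are $1/\lambda_n$. *)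

(* Defs.v *)
From Stdlib Require Import Reals.
From Coquelicot Require Import Coquelicot.
Open Scope R_scope.

(* Derivative relative to [0,1]: the ordinary derivative for 0 < x < 1, the
   one-sided derivative at the endpoints.  This is [is_derive] with the filter
   [locally x] restricted to [0,1], so values of [f] outside [0,1] play no
   role. *)
Definition is_derive_unit (f : R -> C) (x : R) (l : C) : Prop :=
  filterdiff (K := R_AbsRing) (U := R_NormedModule) (V := C_R_NormedModule)
    f (within (fun y : R => 0 <= y <= 1) (locally x))
    (fun h : R => scal h (l : C_R_NormedModule)).

(* [dphi] is the derivative of [phi] on [0,1].  Its continuity up to the
   endpoints is not imposed: it follows from the equation on (0,1). *)
Definition is_bvp_solution (lambda : C) (phi dphi : R -> C) : Prop :=
  (forall x : R, 0 <= x <= 1 -> is_derive_unit phi x (dphi x)) /\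
  (forall x : R, 0 < x < 1 ->
     exists d2 : C,
       is_derive (K := R_AbsRing) (V := C_R_NormedModule) dphi x d2 /\
       (- d2)%C = (lambda * phi x)%C) /\
  (phi 0 + phi 1)%C = (- dphi 0)%C /\
  (- dphi 0)%C = dphi 1.

(* Eigenvalues are not assumed real. *)
Definition is_eigenvalue (lambda : C) : Prop :=
  exists phi dphi : R -> C,
    is_bvp_solution lambda phi dphi /\
    exists x : R, 0 <= x <= 1 /\ phi x <> RtoC 0.

Definition K (x y : R) : R := - Rabs (x - y) / 2.

(* Each eigenvalue is listed exactly once (every eigenspace is
   one-dimensional), in an arbitrary order. *)
Definition enumerates_eigenvalues (lambda : nat -> C) : Prop :=
  (forall m n : nat, lambda m = lambda n -> m = n) /\
  (forall z : C, is_eigenvalue z <-> exists n : nat, lambda n = z).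

(* Main.v *)
Require Import Defs.
From Stdlib Require Import Reals Lra Lia ClassicalEpsilon.
From Coquelicot Require Import Coquelicot.
Open Scope R_scope.

(** The diagonal of the kernel vanishes, so the integral is 0 and the content
    is that the reciprocals of the eigenvalues sum to 0.

    Eigenvalues.  The problem is symmetric under x -> 1 - x.  The boundary
    conditions make the Wronskian of the real and imaginary parts of an
    eigenfunction equal at 0 and 1, while its derivative is
    - Im lambda * |phi|^2; hence eigenvalues are real ([eigenvalue_real]).  For
    real a, expanding a solution in its even and odd parts about 1/2 turns the
    boundary conditions into one scalar equation for each parity
    ([eigenvalue_iff_characteristic]).  With a = 4 z^2 the odd part gives
    cos z = 0 and the even part cos z + z sin z = 0; with a = - 4 m^2 only
    cosh m = m sinh m remains; a = 0 gives nothing.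

    Sums.  Up to the factor 1/8 the two families contribute the sums of 2 / z^2
    over the zeros of cos z and of cos z + z sin z, where the imaginary zero
    z = i m counts as - 2 / m^2.  A Hadamard product would give these sums from
    the quadratic Taylor coefficients: 1 and - 1.  Here the entire functions
    are replaced by polynomials in x = cos (z / n), which are products over
    their zeros for algebraic reasons.  With T = T_n and U = U_(n-1) the
    Chebyshev polynomials,
      T (cos (z/n)) = cos z,
      (T + n (1 - x^2) U) (cos (z/n)) = cos z + n sin (z/n) sin z.
    The zeros are explicit for the first polynomial and located by sign changes
    for the second.  The logarithmic derivative at x = 1 then gives the sum of
    1 / (1 - x_k) exactly: n^2 for the first and n^2 - 2 n^2 = - n^2 for the
    second
    ([sum_inv_chebT_roots], [sum_inv_even_roots]).  Since
    n^2 (1 - cos (z/n)) tends to z^2 / 2 and the discrete zeros tend to the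
    continuous ones, dominated convergence yields [is_series_half_odd_pi] and
    [sum_even_and_hyp].  The two contributions are 1/8 and - 1/8.

    Order of summation.  Both families are absolutely summable, so any
    enumeration of their union gives the same sum ([is_series_reindex]). *)

(** * Dominated convergence for series *)

Lemma is_lim_seq_sum_n (a : nat -> nat -> R) (l : nat -> R) (N : nat) :
  (forall k, is_lim_seq (fun n => a n k) (l k)) ->
  is_lim_seq (fun n => sum_n (a n) N) (sum_n l N).
Proof.
  intros Hlim; induction N as [|N IH].
  - apply is_lim_seq_ext with (fun n => a n 0%nat).
    + intros n; now rewrite sum_O.
    + rewrite sum_O; apply Hlim.
  - apply is_lim_seq_ext with (fun n => sum_n (a n) N + a n (S N)).
    + intros n; now rewrite sum_Sn.
    + rewrite sum_Sn; now apply (is_lim_seq_plus' _ _ (sum_n l N) (l (S N))).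
Qed.

Lemma Series_split (a : nat -> R) (N : nat) :
  ex_series a ->
  Series a = sum_n a N + Series (fun k => a (S N + k)%nat).
Proof.
  intros Ha; rewrite (Series_incr_n a (S N)); [|lia|exact Ha].
  now rewrite sum_n_Reals.
Qed.

Lemma Series_tail_lim (a : nat -> R) :
  ex_series a -> is_lim_seq (fun N => Series (fun k => a (S N + k)%nat)) 0.
Proof.
  intros Ha.
  apply is_lim_seq_ext with (fun N => Series a - sum_n a N).
  - intros N; rewrite (Series_split a N Ha); ring.
  - replace (Finite 0) with (Finite (Series a - Series a)) by (f_equal; ring).
    apply (is_lim_seq_minus' _ _ (Series a) (Series a)).
    + apply is_lim_seq_const.
    + exact (Series_correct a Ha).
Qed.

(** Serves twice below: to let the number of zeros grow in the discrete
    identities, and to rearrange an absolutely convergent series. *)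
Lemma tannery (a : nat -> nat -> R) (l M : nat -> R) :
  (forall n k, Rabs (a n k) <= M k) ->
  (forall k, is_lim_seq (fun n => a n k) (l k)) ->
  ex_series M ->
  is_lim_seq (fun n => Series (a n)) (Series l).
Proof.
  intros HM Hl HexM.
  assert (HlM : forall k, Rabs (l k) <= M k).
  { intros k.
    assert (H := is_lim_seq_abs _ _ (Hl k)); simpl in H.
    exact (is_lim_seq_le _ _ (Rabs (l k)) (M k) (fun n => HM n k) H
             (is_lim_seq_const _)). }
  assert (Hexa : forall n, ex_series (a n)) by
    (intros n; exact (ex_series_le (a n) M (HM n) HexM)).
  assert (Hexl : ex_series l) by exact (ex_series_le l M HlM HexM).
  apply is_lim_seq_spec; intros eps.
  assert (Heps : 0 < eps / 4) by (destruct eps; simpl; lra).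
  assert (Htail := Series_tail_lim M HexM).
  apply is_lim_seq_spec in Htail.
  destruct (Htail (mkposreal _ Heps)) as [N HN].
  specialize (HN N (le_n N)); simpl in HN.
  assert (Hfin := is_lim_seq_sum_n a l N Hl).
  apply is_lim_seq_spec in Hfin.
  destruct (Hfin (mkposreal _ Heps)) as [n0 Hn0].
  exists n0; intros n Hn; specialize (Hn0 n Hn); simpl in Hn0.
  assert (HexT : ex_series (fun k => M (S N + k)%nat))
    by now apply (ex_series_incr_n M (S N)).
  assert (Hb : forall b, (forall k, Rabs (b k) <= M k) ->
     Rabs (Series (fun k => b (S N + k)%nat))
       <= Series (fun k => M (S N + k)%nat)).
  { intros b Hb; eapply Rle_trans.
    - apply Series_Rabs.
      apply (ex_series_le (V := R_CompleteNormedModule) _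
        (fun k => M (S N + k)%nat)); [|exact HexT].
      intros k; unfold norm; simpl; unfold abs; simpl.
      rewrite Rabs_Rabsolu; apply Hb.
    - apply Series_le; [|exact HexT].
      intros k; split; [apply Rabs_pos|apply Hb]. }
  assert (H1 := Hb _ (HM n)); assert (H2 := Hb _ HlM).
  rewrite (Series_split (a n) N), (Series_split l N) by auto.
  simpl in *; unfold Rminus in *; rewrite Ropp_0, Rplus_0_r in HN.
  revert Hn0 H1 H2 HN; unfold Rabs; repeat destruct Rcase_abs; lra.
Qed.

Lemma is_series_finite (f : nat -> R) (N : nat) :
  is_series (fun k => if (k <=? N)%nat then f k else 0) (sum_n f N).
Proof.
  apply (is_lim_seq_ext_loc (fun _ => sum_n f N) _ (sum_n f N));
    [|apply is_lim_seq_const].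
  exists N; intros m Hm; induction Hm as [|m Hm IH].
  - apply sum_n_ext_loc; intros k Hk.
    now rewrite (proj2 (Nat.leb_le k N) Hk).
  - rewrite sum_Sn, <- IH, (proj2 (Nat.leb_gt (S m) N)) by lia.
    symmetry; apply Rplus_0_r.
Qed.

Lemma ex_series_inv_square : ex_series (fun k => / (INR k + 1) ^ 2).
Proof.
  assert (Htel : is_series (fun k => / (INR k + 1) - / (INR k + 2)) 1).
  { apply (is_lim_seq_ext (fun n => 1 - / (INR n + 2)) _ 1).
    - intros n; induction n as [|n IH].
      + rewrite sum_O; simpl; field.
      + rewrite sum_Sn, <- IH, S_INR; unfold plus; simpl.
        assert (H := pos_INR n); field; lra.
    - replace (Finite 1) with (Finite (1 - 0)) by (f_equal; ring).
      apply (is_lim_seq_minus' _ _ 1 0); [apply is_lim_seq_const|].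
      apply (is_lim_seq_inv _ p_infty); [|discriminate].
      apply is_lim_seq_ext with (fun n => INR (n + 2)).
      + intros n; rewrite plus_INR; simpl; ring.
      + apply -> (is_lim_seq_incr_n INR 2); apply is_lim_seq_INR. }
  apply (ex_series_le (V := R_CompleteNormedModule) _
    (fun k => 2 * (/ (INR k + 1) - / (INR k + 2)))).
  - intros k; assert (H := pos_INR k).
    unfold norm; simpl; unfold abs; simpl.
    rewrite Rabs_pos_eq.
    + replace (2 * (/ (INR k + 1) - / (INR k + 2)))
        with (/ ((INR k + 1) * ((INR k + 2) / 2))) by (field; lra).
      apply Rinv_le_contravar; [apply Rmult_lt_0_compat; lra|].
      rewrite Rmult_1_r; apply Rmult_le_compat_l; lra.
    + left; apply Rinv_0_lt_compat; nra.
  - exists (2 * 1); now apply (is_series_scal_l 2) in Htel.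
Qed.

(** * Polynomial functions *)

(** Degree at most [d], in Horner form: division by a linear factor then
    follows the recursion and needs no coefficient sequences. *)
Inductive poly_fun : nat -> (R -> R) -> Prop :=
| poly_const c f : (forall x, f x = c) -> poly_fun 0 f
| poly_step d c g f :
    poly_fun d g -> (forall x, f x = c + x * g x) -> poly_fun (S d) f.

Lemma poly_fun_ext d f g :
  (forall x, f x = g x) -> poly_fun d f -> poly_fun d g.
Proof.
  intros Hfg Hf; revert Hfg; destruct Hf as [c f Hc | d c h f Hh Hc];
    intros Hfg.
  - apply poly_const with c; intros x; now rewrite <- Hfg.
  - apply poly_step with c h; [exact Hh|]; intros x; now rewrite <- Hfg.
Qed.

Lemma poly_fun_S d f : poly_fun d f -> poly_fun (S d) f.
Proof.
  induction 1 as [c f Hc | d c g f Hg IH Hc].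
  - apply poly_step with c (fun _ => 0).
    + now apply poly_const with 0.
    + intros x; rewrite Hc; ring.
  - now apply poly_step with c g.
Qed.

Lemma poly_fun_plus d f g :
  poly_fun d f -> poly_fun d g -> poly_fun d (fun x => f x + g x).
Proof.
  intros Hf; revert g; induction Hf as [c f Hc | d c f' f Hf IH Hc];
    intros g Hg.
  - inversion Hg as [c' g' Hc' |]; subst.
    apply poly_const with (c + c'); intros x; now rewrite Hc, Hc'.
  - inversion Hg as [| d' c' g' g'' Hg' Hc']; subst.
    apply poly_step with (c + c') (fun x => f' x + g' x); [now apply IH|].
    intros x; rewrite Hc, Hc'; ring.
Qed.

Lemma poly_fun_scal d k f : poly_fun d f -> poly_fun d (fun x => k * f x).
Proof.
  induction 1 as [c f Hc | d c g f Hg IH Hc].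
  - apply poly_const with (k * c); intros x; now rewrite Hc.
  - apply poly_step with (k * c) (fun x => k * g x); [exact IH|].
    intros x; rewrite Hc; ring.
Qed.

Lemma poly_fun_mulX d f : poly_fun d f -> poly_fun (S d) (fun x => x * f x).
Proof.
  intros Hf; apply poly_step with 0 f; [exact Hf|]; intros x; ring.
Qed.

Lemma poly_fun_div d f r :
  poly_fun (S d) f ->
  exists g, poly_fun d g /\ forall x, f x = f r + (x - r) * g x.
Proof.
  revert f; induction d as [|d IH]; intros f Hf;
    inversion Hf as [| d' c g f' Hg Hc]; subst.
  - exists g; split; [exact Hg|].
    inversion Hg as [c' g' Hc' |]; subst.
    intros x; rewrite !Hc, !Hc'; ring.
  - destruct (IH g Hg) as [h [Hh Hgh]].
    exists (fun x => g r + x * h x); split.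
    + now apply poly_step with (g r) h.
    + intros x; rewrite !Hc, (Hgh x); ring.
Qed.

Lemma poly_fun_ex_derive d f x : poly_fun d f -> ex_derive f x.
Proof.
  induction 1 as [c f Hc | d c g f Hg IH Hc].
  - apply ex_derive_ext with (fun _ => c); [now intros t|].
    apply ex_derive_const.
  - apply ex_derive_ext with (fun t => c + t * g t); [now intros t|].
    auto_derive; auto.
Qed.

Lemma poly_log_derivative_factor d f g r a (f' : R) :
  poly_fun d g -> (forall x, f x = (x - r) * g x) ->
  f a <> 0 -> is_derive f a f' ->
  exists g' : R, is_derive g a g' /\ g a <> 0 /\ f' / f a = / (a - r) + g' / g a.
Proof.
  intros Hg Hfg Ha Hd.
  assert (Hga : g a <> 0) by (intros H0; apply Ha; rewrite Hfg, H0; ring).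
  assert (Hra : a - r <> 0) by (intros H0; apply Ha; rewrite Hfg, H0; ring).
  destruct (poly_fun_ex_derive d g a Hg) as [g' Hg'].
  exists g'; split; [exact Hg'|split; [exact Hga|]].
  assert (Hd' : is_derive f a (g a + (a - r) * g')).
  { apply is_derive_ext with (fun x => (x - r) * g x); [now intros t|].
    auto_derive; [now exists g'|].
    replace (Derive _ a) with g' by (symmetry; now apply is_derive_unique).
    ring. }
  replace f' with (g a + (a - r) * g').
  - rewrite Hfg; field; auto.
  - now rewrite <- (is_derive_unique _ _ _ Hd'); apply is_derive_unique.
Qed.

(** A polynomial with as many distinct zeros as its degree is a constant
    times the product of the [x - r i], so its logarithmic derivative at [a] is
    the sum of the [/ (a - r i)].  Splitting off one zero at a time avoids
    writing the product. *)
Lemma poly_log_derivative N f (r : nat -> R) a (f' : R) :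
  poly_fun (S N) f ->
  (forall i, (i <= N)%nat -> f (r i) = 0) ->
  (forall i j, (i < j <= N)%nat -> r i <> r j) ->
  f a <> 0 -> is_derive f a f' ->
  sum_n (fun i => / (a - r i)) N = f' / f a.
Proof.
  revert f f'; induction N as [|N IH]; intros f f' Hf Hroot Hdist Ha Hd.
  - destruct (poly_fun_div _ f (r 0%nat) Hf) as [g [Hg Hfg]].
    rewrite (Hroot 0%nat (le_n _)) in Hfg.
    destruct (poly_log_derivative_factor 0 f g (r 0%nat) a f' Hg)
      as [g' [Hg' [Hga ->]]]; auto.
    { intros x; rewrite Hfg; ring. }
    inversion Hg as [c g0 Hc |]; subst.
    replace g' with 0.
    { rewrite sum_O.
      change (/ (a - r 0%nat) = / (a - r 0%nat) + 0 / g a).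
      field; split; [exact Hga|].
      intros H0; apply Ha; rewrite Hfg, H0; ring. }
    rewrite <- (is_derive_unique _ _ _ Hg').
    rewrite (Derive_ext g (fun _ => c)) by exact Hc.
    symmetry; apply Derive_const.
  - destruct (poly_fun_div _ f (r (S N)) Hf) as [g [Hg Hfg]].
    rewrite (Hroot (S N) (le_n _)) in Hfg.
    destruct (poly_log_derivative_factor _ f g (r (S N)) a f' Hg)
      as [g' [Hg' [Hga ->]]]; auto.
    { intros x; rewrite Hfg; ring. }
    rewrite sum_Sn, (IH g g' Hg); [apply Rplus_comm| | |exact Hga|exact Hg'].
    + intros i Hi; assert (H := Hfg (r i)).
      rewrite Hroot in H by lia.
      assert (r i <> r (S N)) by (apply Hdist; lia).
      assert (H1 : (r i - r (S N)) * g (r i) = 0) by lra.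
      apply Rmult_integral in H1; destruct H1; [lra|assumption].
    + intros i j Hij; apply Hdist; lia.
Qed.

(** * Chebyshev polynomials *)

(** The pair of T_n and U_(n-1), with U_(-1) = 0.  Both are generated together
    because the recursion is then the pair of addition formulas for
    [cos (n t + t)] and [sin (n t + t) / sin t], and the same recursion serves
    cosh and sinh. *)
Fixpoint cheb (n : nat) (x : R) : R * R :=
  match n with
  | O => (1, 0)
  | S m => let (T, U) := cheb m x in (x * T - (1 - x ^ 2) * U, x * U + T)
  end.
Definition chebT n x := fst (cheb n x).
Definition chebU n x := snd (cheb n x).

Lemma chebT_S n x : chebT (S n) x = x * chebT n x - (1 - x ^ 2) * chebU n x.
Proof. unfold chebT, chebU; simpl; now destruct (cheb n x). Qed.

Lemma chebU_S n x : chebU (S n) x = x * chebU n x + chebT n x.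
Proof. unfold chebT, chebU; simpl; now destruct (cheb n x). Qed.

Lemma cheb_cos n t :
  chebT n (cos t) = cos (INR n * t) /\
  sin t * chebU n (cos t) = sin (INR n * t).
Proof.
  induction n as [|n [IHT IHU]].
  - unfold chebT, chebU; simpl; rewrite Rmult_0_l, cos_0, sin_0; lra.
  - rewrite S_INR, chebT_S, chebU_S.
    replace ((INR n + 1) * t) with (INR n * t + t) by ring.
    rewrite cos_plus, sin_plus, <- IHT, <- IHU.
    assert (H := sin2_cos2 t); unfold Rsqr in H.
    split; [|ring].
    replace (1 - cos t ^ 2) with (sin t * sin t) by (simpl; lra); ring.
Qed.

Lemma cosh_plus x y : cosh (x + y) = cosh x * cosh y + sinh x * sinh y.
Proof.
  unfold cosh, sinh; rewrite Ropp_plus_distr, !exp_plus; field.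
Qed.

Lemma sinh_plus x y : sinh (x + y) = sinh x * cosh y + cosh x * sinh y.
Proof.
  unfold cosh, sinh; rewrite Ropp_plus_distr, !exp_plus; field.
Qed.

Lemma cosh2_sinh2 x : cosh x ^ 2 - sinh x ^ 2 = 1.
Proof.
  unfold cosh, sinh.
  assert (H : exp x * exp (- x) = 1)
    by (rewrite <- exp_plus, Rplus_opp_r; apply exp_0).
  nra.
Qed.

Lemma cheb_cosh n t :
  chebT n (cosh t) = cosh (INR n * t) /\
  sinh t * chebU n (cosh t) = sinh (INR n * t).
Proof.
  induction n as [|n [IHT IHU]].
  - unfold chebT, chebU; simpl; rewrite Rmult_0_l, cosh_0, sinh_0; lra.
  - rewrite S_INR, chebT_S, chebU_S.
    replace ((INR n + 1) * t) with (INR n * t + t) by ring.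
    rewrite cosh_plus, sinh_plus, <- IHT, <- IHU.
    assert (H := cosh2_sinh2 t).
    split; [|ring].
    replace (1 - cosh t ^ 2) with (- (sinh t * sinh t)) by (simpl in *; lra).
    ring.
Qed.

Lemma cheb_poly n : poly_fun (S n) (chebT (S n)) /\ poly_fun n (chebU (S n)).
Proof.
  induction n as [|n [IHT IHU]].
  - split.
    + apply poly_step with 0 (fun _ => 1); [now apply poly_const with 1|].
      intros x; unfold chebT; simpl; ring.
    + apply poly_const with 1; intros x; unfold chebU; simpl; ring.
  - split.
    + apply poly_fun_ext with (fun x =>
        (x * chebT (S n) x + x * (x * chebU (S n) x)) + -1 * chebU (S n) x).
      { intros x; rewrite (chebT_S (S n)); ring. }
      apply poly_fun_plus; [apply poly_fun_plus|].
      * now apply poly_fun_mulX.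
      * now apply poly_fun_mulX, poly_fun_mulX.
      * now apply poly_fun_scal, poly_fun_S, poly_fun_S.
    + apply poly_fun_ext with (fun x => x * chebU (S n) x + chebT (S n) x).
      { intros x; now rewrite (chebU_S (S n)). }
      apply poly_fun_plus; [now apply poly_fun_mulX|exact IHT].
Qed.

Lemma cheb_at_1 n : chebT n 1 = 1 /\ chebU n 1 = INR n.
Proof.
  induction n as [|n [IHT IHU]].
  - now split.
  - rewrite chebT_S, chebU_S, IHT, IHU, S_INR; split; ring.
Qed.

Lemma chebU_ex_derive n x : ex_derive (chebU n) x.
Proof.
  destruct n as [|n].
  - apply (ex_derive_const 0).
  - apply (poly_fun_ex_derive n), cheb_poly.
Qed.

Lemma chebT_derive_1 n : is_derive (chebT n) 1 (INR n ^ 2).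
Proof.
  induction n as [|n IH].
  - replace (INR 0 ^ 2) with 0 by (simpl; ring).
    apply (is_derive_const 1).
  - apply is_derive_ext with
      (fun x => x * chebT n x - (1 - x ^ 2) * chebU n x).
    { intros t; now rewrite chebT_S. }
    auto_derive.
    + split; [now exists (INR n ^ 2)|]; split; [apply chebU_ex_derive|easy].
    + replace (Derive (fun x => chebT n x) 1) with (INR n ^ 2)
        by (symmetry; now apply is_derive_unique).
      destruct (cheb_at_1 n) as [-> ->].
      rewrite S_INR; ring.
Qed.

(** * Zeros of the discrete characteristic polynomials *)

Definition half_odd_pi (k : nat) : R := (INR k + / 2) * PI.

Lemma cos_shift_pi k x : cos (x + INR k * PI) = (-1) ^ k * cos x.
Proof.
  induction k as [|k IH].
  - simpl; rewrite Rmult_0_l, Rplus_0_r; ring.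
  - rewrite S_INR.
    replace (x + (INR k + 1) * PI) with (x + INR k * PI + PI) by ring.
    rewrite neg_cos, IH; simpl; ring.
Qed.

Lemma sin_shift_pi k x : sin (x + INR k * PI) = (-1) ^ k * sin x.
Proof.
  induction k as [|k IH].
  - simpl; rewrite Rmult_0_l, Rplus_0_r; ring.
  - rewrite S_INR.
    replace (x + (INR k + 1) * PI) with (x + INR k * PI + PI) by ring.
    rewrite neg_sin, IH; simpl; ring.
Qed.

Lemma cos_half_odd_pi k y : cos (y + half_odd_pi k) = - (-1) ^ k * sin y.
Proof.
  unfold half_odd_pi.
  replace (y + (INR k + / 2) * PI) with (PI / 2 + y + INR k * PI) by field.
  rewrite cos_shift_pi, (sin_cos y); ring.
Qed.

Lemma sin_half_odd_pi k y : sin (y + half_odd_pi k) = (-1) ^ k * cos y.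
Proof.
  unfold half_odd_pi.
  replace (y + (INR k + / 2) * PI) with (PI / 2 + y + INR k * PI) by field.
  now rewrite sin_shift_pi, <- cos_sin.
Qed.

Lemma INR_S_pos N : 0 < INR (S N).
Proof. apply lt_0_INR; lia. Qed.

Lemma cos_scaled_neq N (z : nat -> R) :
  (forall k, (k <= N)%nat -> INR k * PI < z k < (INR k + 1) * PI) ->
  forall i j, (i < j <= N)%nat ->
    cos (z i / INR (S N)) <> cos (z j / INR (S N)).
Proof.
  intros Hz i j Hij.
  assert (HN := INR_S_pos N); assert (HPI := PI_RGT_0).
  destruct (Hz i) as [Hi1 Hi2]; [lia|]; destruct (Hz j) as [Hj1 Hj2]; [lia|].
  assert (Hi0 := pos_INR i).
  assert (Hlt : z i / INR (S N) < z j / INR (S N)).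
  { apply Rmult_lt_compat_r; [now apply Rinv_0_lt_compat|].
    assert (INR i + 1 <= INR j) by (rewrite <- S_INR; apply le_INR; lia).
    nra. }
  assert (0 < z i / INR (S N)).
  { apply Rdiv_lt_0_compat; nra. }
  assert (z j / INR (S N) <= PI).
  { apply Rle_div_l; [exact HN|].
    assert (INR j + 1 <= INR (S N)) by (rewrite <- S_INR; apply le_INR; lia).
    nra. }
  assert (H2 := cos_decreasing_1 (z i / INR (S N)) (z j / INR (S N))).
  lra.
Qed.

Lemma half_odd_pi_bounds k :
  INR k * PI < half_odd_pi k /\
  half_odd_pi k + PI / 2 = (INR k + 1) * PI.
Proof.
  assert (H := PI_RGT_0); unfold half_odd_pi; split; [nra|field].
Qed.

Lemma half_odd_pi_pos k : 0 < half_odd_pi k.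
Proof.
  destruct (half_odd_pi_bounds k) as [H _].
  assert (H1 := pos_INR k); assert (H2 := PI_RGT_0); nra.
Qed.

(** The numbers [cos (half_odd_pi k / n)] are the n zeros of T_n, and
    T_n' (1) = n^2. *)
Lemma sum_inv_chebT_roots N :
  sum_n (fun k => / (1 - cos (half_odd_pi k / INR (S N)))) N = INR (S N) ^ 2.
Proof.
  assert (HN := INR_S_pos N).
  rewrite (poly_log_derivative N (chebT (S N))
             (fun k => cos (half_odd_pi k / INR (S N))) 1 (INR (S N) ^ 2)).
  - rewrite (proj1 (cheb_at_1 _)); apply Rdiv_1_r.
  - apply cheb_poly.
  - intros k Hk; rewrite (proj1 (cheb_cos _ _)).
    replace (INR (S N) * (half_odd_pi k / INR (S N)))
      with (0 + half_odd_pi k) by (field; lra).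
    rewrite cos_half_odd_pi, sin_0; ring.
  - apply cos_scaled_neq; intros k _.
    destruct (half_odd_pi_bounds k); assert (H1 := PI_RGT_0); lra.
  - rewrite (proj1 (cheb_at_1 _)); lra.
  - apply chebT_derive_1.
Qed.

Lemma cosh_gt_1 t : 0 < t -> 1 < cosh t.
Proof.
  intros Ht; assert (H := cosh2_sinh2 t).
  assert (0 < sinh t) by (rewrite <- sinh_0; now apply sinh_lt).
  assert (0 < cosh t)
    by (unfold cosh; assert (A := exp_pos t); assert (B := exp_pos (- t)); lra).
  nra.
Qed.

(** The polynomial T_n + n (1 - x^2) U_(n-1) has degree n + 1.  The
    hypotheses provide n zeros [cos (z k / n)] inside (-1, 1) and one zero
    [cosh (m / n)] beyond 1, hence all of them.  At 1 its value is 1, and the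
    extra term turns the derivative n^2 of T_n into n^2 - 2 n * n. *)
Lemma sum_inv_even_roots N (z : nat -> R) (m : R) :
  (forall k, (k <= N)%nat -> INR k * PI < z k < (INR k + 1) * PI) ->
  (forall k, (k <= N)%nat ->
     cos (z k) + INR (S N) * sin (z k / INR (S N)) * sin (z k) = 0) ->
  0 < m -> cosh m - INR (S N) * sinh (m / INR (S N)) * sinh m = 0 ->
  sum_n (fun k => / (1 - cos (z k / INR (S N)))) N
    + / (1 - cosh (m / INR (S N))) = - INR (S N) ^ 2.
Proof.
  intros Hz Hroot Hm Hhyp.
  assert (HN := INR_S_pos N).
  remember (S N) as n eqn:En.
  set (f := fun x => chebT n x + INR n * ((1 - x ^ 2) * chebU n x)).
  set (r := fun k => if (k <=? N)%nat then cos (z k / INR n)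
                     else cosh (m / INR n)).
  assert (Hsum : sum_n (fun k => / (1 - r k)) (S N)
    = sum_n (fun k => / (1 - cos (z k / INR n))) N
      + / (1 - cosh (m / INR n))).
  { rewrite sum_Sn; unfold plus; simpl; f_equal.
    - apply sum_n_ext_loc; intros k Hk; unfold r.
      now rewrite (proj2 (Nat.leb_le k N) Hk).
    - unfold r; now rewrite (proj2 (Nat.leb_gt (S N) N) (Nat.lt_succ_diag_r N)). }
  assert (Hf1 : f 1 = 1).
  { unfold f; rewrite (proj1 (cheb_at_1 n)); ring. }
  rewrite <- Hsum, (poly_log_derivative (S N) f r 1 (- INR n ^ 2)).
  - rewrite Hf1; apply Rdiv_1_r.
  - unfold f; rewrite En.
    apply poly_fun_ext with (fun x => chebT (S N) x
       + INR (S N) * (chebU (S N) x + -1 * (x * (x * chebU (S N) x)))).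
    { intros x; ring. }
    destruct (cheb_poly N) as [HT HU].
    apply poly_fun_plus; [now apply poly_fun_S|].
    apply poly_fun_scal, poly_fun_plus; [now apply poly_fun_S, poly_fun_S|].
    now apply poly_fun_scal, poly_fun_mulX, poly_fun_mulX.
  - intros k Hk; unfold f, r.
    destruct (Nat.leb_spec k N) as [HkN|HkN].
    + destruct (cheb_cos n (z k / INR n)) as [HT HU].
      replace (INR n * (z k / INR n)) with (z k) in HT, HU by (field; lra).
      rewrite HT, <- (Hroot k HkN), <- HU.
      assert (H := sin2_cos2 (z k / INR n)); unfold Rsqr in H.
      replace (1 - cos (z k / INR n) ^ 2)
        with (sin (z k / INR n) * sin (z k / INR n)) by lra.
      ring.
    + destruct (cheb_cosh n (m / INR n)) as [HT HU].
      replace (INR n * (m / INR n)) with m in HT, HU by (field; lra).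
      rewrite HT, <- Hhyp, <- HU.
      assert (H := cosh2_sinh2 (m / INR n)).
      replace (1 - cosh (m / INR n) ^ 2)
        with (- (sinh (m / INR n) * sinh (m / INR n))) by lra.
      ring.
  - intros i j Hij; unfold r.
    rewrite (proj2 (Nat.leb_le i N)) by lia.
    destruct (Nat.leb_spec j N) as [HjN|HjN].
    + rewrite En; apply (cos_scaled_neq N z Hz); lia.
    + assert (H1 := COS_bound (z i / INR n)).
      assert (H2 : 0 < m / INR n) by now apply Rdiv_lt_0_compat.
      apply cosh_gt_1 in H2; lra.
  - rewrite Hf1; lra.
  - unfold f; auto_derive.
    + split; [exists (INR n ^ 2); apply chebT_derive_1|].
      split; [apply chebU_ex_derive|easy].
    + replace (Derive (fun x => chebT n x) 1) with (INR n ^ 2)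
        by (symmetry; apply is_derive_unique, chebT_derive_1).
      rewrite (proj2 (cheb_at_1 n)); ring.
Qed.

(** * Passing to the limit *)

(** Stated for bounded sequences because it is applied to discrete roots
    before these are known to converge: it shows that they nearly solve the
    limiting equation. *)
Lemma is_lim_seq_scaled (f : R -> R) (x : nat -> R) (B : R) :
  f 0 = 0 -> is_derive f 0 1 -> eventually (fun N => Rabs (x N) <= B) ->
  is_lim_seq (fun N => INR (S N) * f (x N / INR (S N)) - x N) 0.
Proof.
  intros Hf0 Hf Hx.
  apply is_derive_Reals in Hf.
  apply is_lim_seq_spec; intros eps.
  assert (HB : 0 < Rabs B + 1) by (assert (H := Rabs_pos B); lra).
  assert (He : 0 < eps / (Rabs B + 1))
    by (apply Rdiv_lt_0_compat; [apply cond_pos|exact HB]).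
  destruct (Hf _ He) as [[d Hd] Hfd]; simpl in Hfd.
  destruct Hx as [N0 HN0].
  destruct (nfloor_ex ((Rabs B + 1) / d)) as [N1 [_ HN1]].
  { left; now apply Rdiv_lt_0_compat. }
  exists (Nat.max N0 N1); intros N HN.
  assert (HxN := HN0 N ltac:(lia)).
  assert (Hn := INR_S_pos N).
  assert (HBB := Rle_abs B).
  rewrite Rminus_0_r.
  destruct (Req_dec (x N) 0) as [Hx0|Hx0].
  { unfold Rdiv; rewrite Hx0, Rmult_0_l, Hf0, Rmult_0_r, Rminus_0_r, Rabs_R0.
    apply cond_pos. }
  assert (Hh : x N / INR (S N) <> 0).
  { apply Rmult_integral_contrapositive_currified; [exact Hx0|].
    apply Rinv_neq_0_compat; lra. }
  specialize (Hfd _ Hh).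
  assert (Hlt : Rabs (x N / INR (S N)) < d).
  { unfold Rdiv; rewrite Rabs_mult, (Rabs_pos_eq (/ _))
      by (left; now apply Rinv_0_lt_compat).
    apply Rlt_div_l; [exact Hn|].
    apply Rlt_div_l in HN1; [|exact Hd].
    assert (INR N1 + 1 <= INR (S N)) by (rewrite <- S_INR; apply le_INR; lia).
    nra. }
  specialize (Hfd Hlt); rewrite Rplus_0_l, Hf0, Rminus_0_r in Hfd.
  replace (INR (S N) * f (x N / INR (S N)) - x N)
    with ((f (x N / INR (S N)) / (x N / INR (S N)) - 1) * x N)
    by (field; split; [lra|exact Hx0]).
  rewrite Rabs_mult.
  apply Rle_lt_trans with (eps / (Rabs B + 1) * Rabs B).
  - apply Rmult_le_compat; try apply Rabs_pos; [lra|].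
    apply Rle_trans with B; assumption.
  - assert (E : eps = (eps / (Rabs B + 1)) * (Rabs B + 1) :> R)
      by (field; lra).
    nra.
Qed.

Lemma is_lim_seq_bounded_abs (x : nat -> R) (l : R) :
  is_lim_seq x l -> eventually (fun N => Rabs (x N) <= Rabs l + 1).
Proof.
  intros Hx; apply is_lim_seq_spec in Hx.
  destruct (Hx (mkposreal 1 Rlt_0_1)) as [N0 HN0]; exists N0; intros N HN.
  specialize (HN0 N HN); simpl in HN0.
  revert HN0; unfold Rabs; repeat destruct Rcase_abs; lra.
Qed.

Lemma is_lim_seq_scaled_cvg (f : R -> R) (x : nat -> R) (l : R) :
  f 0 = 0 -> is_derive f 0 1 -> is_lim_seq x l ->
  is_lim_seq (fun N => INR (S N) * f (x N / INR (S N))) l.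
Proof.
  intros Hf0 Hf Hx.
  apply is_lim_seq_ext with
    (fun N => (INR (S N) * f (x N / INR (S N)) - x N) + x N).
  { intros N; ring. }
  replace (Finite l) with (Finite (0 + l)) by (f_equal; ring).
  apply (is_lim_seq_plus' _ _ 0 l); [|exact Hx].
  apply is_lim_seq_scaled with (Rabs l + 1); auto.
  now apply is_lim_seq_bounded_abs.
Qed.

Lemma is_derive_sin_0 : is_derive sin 0 1.
Proof. rewrite <- cos_0; apply is_derive_Reals, derivable_pt_lim_sin. Qed.

Lemma is_derive_sinh_0 : is_derive sinh 0 1.
Proof. rewrite <- cosh_0; apply is_derive_Reals, derivable_pt_lim_sinh. Qed.

Lemma is_lim_seq_half (x : nat -> R) (l : R) :
  is_lim_seq x l -> is_lim_seq (fun N => x N / 2) (l / 2).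
Proof. intros Hx; exact (is_lim_seq_scal_r x (/ 2) l Hx). Qed.

Lemma one_minus_cos t : 1 - cos t = 2 * sin (t / 2) ^ 2.
Proof.
  replace t with (2 * (t / 2)) at 1 by field; rewrite cos_2a_sin; ring.
Qed.

Lemma one_minus_cosh t : 1 - cosh t = - (2 * sinh (t / 2) ^ 2).
Proof.
  replace t with (t / 2 + t / 2) at 1 by field; rewrite cosh_plus.
  assert (H := cosh2_sinh2 (t / 2)); nra.
Qed.

Lemma is_lim_seq_scaled_sqr (f : R -> R) (x : nat -> R) (l : R) :
  f 0 = 0 -> is_derive f 0 1 -> is_lim_seq x l ->
  is_lim_seq (fun N => INR (S N) ^ 2 * (2 * f (x N / INR (S N) / 2) ^ 2))
    (l ^ 2 / 2).
Proof.
  intros Hf0 Hf Hx.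
  assert (H := is_lim_seq_scaled_cvg f _ _ Hf0 Hf (is_lim_seq_half x l Hx)).
  assert (H2 := is_lim_seq_mult' _ _ _ _ H H).
  assert (H3 := is_lim_seq_mult' _ _ _ _ (is_lim_seq_const 2) H2).
  replace (l ^ 2 / 2) with (2 * (l / 2 * (l / 2))) by field.
  apply is_lim_seq_ext with (2 := H3); intros N.
  replace (x N / 2 / INR (S N)) with (x N / INR (S N) / 2)
    by (field; apply not_0_INR; lia).
  cbv beta; ring.
Qed.

Lemma is_lim_seq_scaled_cos (x : nat -> R) (l : R) :
  is_lim_seq x l ->
  is_lim_seq (fun N => INR (S N) ^ 2 * (1 - cos (x N / INR (S N))))
    (l ^ 2 / 2).
Proof.
  intros Hx.
  apply is_lim_seq_ext with (2 := is_lim_seq_scaled_sqr sin x l sin_0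
                               is_derive_sin_0 Hx).
  intros N; now rewrite one_minus_cos.
Qed.

Lemma is_lim_seq_scaled_cosh (x : nat -> R) (l : R) :
  is_lim_seq x l ->
  is_lim_seq (fun N => INR (S N) ^ 2 * (1 - cosh (x N / INR (S N))))
    (- (l ^ 2 / 2)).
Proof.
  intros Hx.
  assert (H := is_lim_seq_scaled_sqr sinh x l sinh_0 is_derive_sinh_0 Hx).
  assert (H2 := is_lim_seq_mult' _ _ _ _ (is_lim_seq_const (- 1)) H).
  replace (- (l ^ 2 / 2)) with (- 1 * (l ^ 2 / 2)) by field.
  apply is_lim_seq_ext with (2 := H2).
  intros N; rewrite one_minus_cosh; ring.
Qed.

(** A crude form of the Jordan inequality; [2] is a convenient bound above
    [PI / 2]. *)
Lemma sin_ge_third x : 0 <= x <= 2 -> x / 3 <= sin x.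
Proof.
  intros Hx.
  assert (H := pre_sin_bound x 0); destruct H as [H _]; [lra|lra|].
  apply Rle_trans with (2 := H).
  unfold sin_approx, sin_term; simpl.
  set (y := x * x).
  assert (0 <= y <= 4) by (unfold y; nra).
  replace (_ + _) with (x * (1 - y / 6))
    by (unfold y; field).
  unfold Rdiv; apply Rmult_le_compat_l; nra.
Qed.

(** The summable majorant needed for dominated convergence.  The range of
    [z] keeps [z / n] in [0, PI], where [1 - cos t] is at least [t ^ 2 / 18]. *)
Lemma scaled_cos_lower N k z :
  (k <= N)%nat -> half_odd_pi k <= z <= half_odd_pi k + PI / 2 ->
  (INR k + 1) ^ 2 / 8 <= INR (S N) ^ 2 * (1 - cos (z / INR (S N))).
Proof.
  intros HkN [Hz1 Hz2].
  assert (Hn := INR_S_pos N).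
  assert (Hk := pos_INR k).
  assert (HPI : 3 < PI) by (assert (H := PI2_3_2); lra).
  assert (HPI4 := PI_4).
  rewrite (proj2 (half_odd_pi_bounds k)) in Hz2.
  assert (HkN' : INR k + 1 <= INR (S N))
    by (rewrite <- S_INR; apply le_INR; lia).
  unfold half_odd_pi in Hz1.
  set (t := z / INR (S N)).
  assert (Hzt : z = t * INR (S N)) by (unfold t; field; lra).
  assert (Ht0 : 0 <= t) by (unfold t; apply Rdiv_le_0_compat; nra).
  assert (Ht : t <= PI).
  { unfold t; apply Rle_div_l; [exact Hn|nra]. }
  assert (Hs := sin_ge_third (t / 2)); assert (t / 2 / 3 <= sin (t / 2)) by
    (apply Hs; lra).
  rewrite one_minus_cos.
  apply Rle_trans with (INR (S N) ^ 2 * (2 * (t / 2 / 3) ^ 2)).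
  - replace (INR (S N) ^ 2 * (2 * (t / 2 / 3) ^ 2)) with (z ^ 2 / 18)
      by (rewrite Hzt; field).
    assert ((INR k + 1) / 2 * 3 <= z) by nra.
    nra.
  - apply Rmult_le_compat_l; [nra|].
    apply Rmult_le_compat_l; [lra|]; apply pow_incr; lra.
Qed.

(** Dominated convergence for the reciprocal sums.  The localisation of
    [z N k] in the second half of the k-th interval of length [PI] gives a
    majorant that is independent of [N]. *)
Lemma sum_inv_cos_limit (z : nat -> nat -> R) (zeta : nat -> R) :
  (forall N k, (k <= N)%nat ->
     half_odd_pi k <= z N k <= half_odd_pi k + PI / 2) ->
  (forall k, is_lim_seq (fun N => z N k) (zeta k)) ->
  ex_series (fun k => 2 / zeta k ^ 2) /\
  is_lim_seq (fun N =>
      sum_n (fun k => / (1 - cos (z N k / INR (S N)))) N / INR (S N) ^ 2)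
    (Series (fun k => 2 / zeta k ^ 2)).
Proof.
  intros Hz Hlim.
  set (M := fun k => 8 * / (INR k + 1) ^ 2).
  assert (HexM : ex_series M).
  { destruct ex_series_inv_square as [l Hl]; exists (8 * l).
    now apply (is_series_scal_l 8) in Hl. }
  set (a := fun N k => if (k <=? N)%nat
     then / (INR (S N) ^ 2 * (1 - cos (z N k / INR (S N)))) else 0).
  assert (HaM : forall N k, Rabs (a N k) <= M k).
  { intros N k; unfold a, M; assert (Hk := pos_INR k).
    assert (Hk2 : 0 < (INR k + 1) ^ 2 / 8) by nra.
    replace (8 * / (INR k + 1) ^ 2) with (/ ((INR k + 1) ^ 2 / 8))
      by (field; lra).
    destruct (Nat.leb_spec k N) as [HkN|_].
    - assert (H := scaled_cos_lower N k _ HkN (Hz N k HkN)).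
      rewrite Rabs_pos_eq by (left; apply Rinv_0_lt_compat; lra).
      now apply Rinv_le_contravar.
    - rewrite Rabs_R0; left; now apply Rinv_0_lt_compat. }
  assert (Hal : forall k, is_lim_seq (fun N => a N k) (2 / zeta k ^ 2)).
  { intros k.
    assert (Hzeta : half_odd_pi k <= zeta k).
    { apply (is_lim_seq_le_loc (fun _ => half_odd_pi k) (fun N => z N k)
               (half_odd_pi k) (zeta k)); [|apply is_lim_seq_const|apply Hlim].
      exists k; intros N HN; now apply Hz. }
    assert (Hz0 : 0 < zeta k).
    { destruct (half_odd_pi_bounds k) as [H _].
      assert (Hk := pos_INR k); assert (HPI := PI_RGT_0); nra. }
    assert (H := is_lim_seq_scaled_cos _ _ (Hlim k)).
    apply is_lim_seq_inv in H; [|intros E; injection E; nra].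
    simpl in H; replace (/ (zeta k * (zeta k * 1) / 2)) with (2 / zeta k ^ 2)
      in H by (field; lra).
    apply is_lim_seq_ext_loc with (2 := H).
    exists k; intros N HN; unfold a.
    now rewrite (proj2 (Nat.leb_le k N) HN). }
  split.
  - apply (ex_series_le (V := R_CompleteNormedModule) _ M); [|exact HexM].
    intros k; unfold norm; simpl; unfold abs; simpl.
    assert (H := is_lim_seq_abs _ _ (Hal k)); simpl in H.
    exact (is_lim_seq_le _ _ _ (M k) (fun N => HaM N k) H
             (is_lim_seq_const _)).
  - apply is_lim_seq_ext with (fun N => Series (a N)).
    2: now apply tannery with M.
    intros N; unfold a.
    rewrite (is_series_unique _ _ (is_series_finite _ N)).
    unfold Rdiv; rewrite Rmult_comm.
    rewrite <- (sum_n_mult_l (K := R_AbsRing)).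
    apply sum_n_ext_loc; intros k Hk.
    rewrite Rinv_mult; reflexivity.
Qed.

Lemma is_series_half_odd_pi : is_series (fun k => 2 / half_odd_pi k ^ 2) 1.
Proof.
  destruct (sum_inv_cos_limit (fun _ k => half_odd_pi k) half_odd_pi)
    as [Hex Hlim].
  - intros N k _; assert (H := PI_RGT_0); lra.
  - intros k; apply is_lim_seq_const.
  - replace 1 with (Series (fun k => 2 / half_odd_pi k ^ 2)).
    { now apply Series_correct. }
    apply is_lim_seq_unique in Hlim.
    assert (H : Lim_seq (fun _ => 1) = 1) by apply Lim_seq_const.
    rewrite (Lim_seq_ext _ (fun _ => 1)), H in Hlim.
    { now injection Hlim. }
    intros N; rewrite sum_inv_chebT_roots.
    assert (Hn := INR_S_pos N); field; lra.
Qed.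

(** * Monotone functions and their roots *)

(** The intermediate point is interior because the derivative of a solution
    is controlled in the open interval only. *)
Lemma mvt_open (f df : R -> R) (a b : R) :
  a < b ->
  (forall x, a < x < b -> is_derive f x (df x)) ->
  (forall x, a <= x <= b -> continuity_pt f x) ->
  exists c, a < c < b /\ f b - f a = df c * (b - a).
Proof.
  intros Hab Hd Hc.
  assert (pr1 : forall c, a < c < b -> derivable_pt f c).
  { intros c Hcab; exists (df c); now apply is_derive_Reals, Hd. }
  assert (pr2 : forall c, a < c < b -> derivable_pt id c).
  { intros c _; apply derivable_pt_id. }
  destruct (MVT f id a b pr1 pr2 Hab Hc) as [c [Hcab E]].
  { intros c _; apply derivable_continuous, derivable_id. }
  exists c; split; [exact Hcab|].
  rewrite (derive_pt_eq_0 f c (df c) (pr1 c Hcab)) in E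
    by now apply is_derive_Reals, Hd.
  rewrite (derive_pt_eq_0 id c 1 (pr2 c Hcab)) in E
    by apply derivable_pt_lim_id.
  unfold id in E; lra.
Qed.

Lemma decreasing_of_derive (f df : R -> R) (a b : R) :
  (forall x, a <= x <= b -> is_derive f x (df x)) ->
  (forall x, a < x < b -> df x < 0) ->
  forall x y, a <= x -> x < y -> y <= b -> f y < f x.
Proof.
  intros Hd Hneg x y Hax Hxy Hyb.
  destruct (mvt_open f df x y Hxy) as [c [Hc E]].
  - intros t Ht; apply Hd; lra.
  - intros t Ht; apply continuity_pt_filterlim, (ex_derive_continuous f).
    exists (df t); apply Hd; lra.
  - assert (H := Hneg c ltac:(lra)); nra.
Qed.

(** Strict monotonicity bounds [F] away from 0 outside any neighbourhood of
    its root, so approximate roots are close to the root. *)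
Lemma root_convergence (F : R -> R) (a b z : R) (x : nat -> R) :
  (forall s t, a <= s -> s < t -> t <= b -> F t < F s) ->
  a <= z <= b -> F z = 0 ->
  eventually (fun N => a <= x N <= b) ->
  is_lim_seq (fun N => F (x N)) 0 ->
  is_lim_seq x z.
Proof.
  intros Hdec Hz Hz0 Hx HF.
  apply is_lim_seq_spec; intros eps.
  assert (Heps := cond_pos eps).
  assert (Hup : exists d, 0 < d /\
    forall t, a <= t <= b -> z + eps <= t -> F t <= - d).
  { destruct (Rle_dec (z + eps) b) as [H|H].
    - exists (- F (z + eps)); split.
      + assert (H1 := Hdec z (z + eps)); lra.
      + intros t Ht [Hlt | <-]; [|lra].
        assert (H1 := Hdec (z + eps) t); lra.
    - exists 1; split; [lra|]; intros; lra. }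
  assert (Hdn : exists d, 0 < d /\
    forall t, a <= t <= b -> t <= z - eps -> d <= F t).
  { destruct (Rle_dec a (z - eps)) as [H|H].
    - exists (F (z - eps)); split.
      + assert (H1 := Hdec (z - eps) z); lra.
      + intros t Ht [Hlt | ->]; [|lra].
        assert (H1 := Hdec t (z - eps)); lra.
    - exists 1; split; [lra|]; intros; lra. }
  destruct Hup as [d1 [Hd1 Hup]]; destruct Hdn as [d2 [Hd2 Hdn]].
  apply is_lim_seq_spec in HF.
  destruct (HF (mkposreal _ (Rmin_pos _ _ Hd1 Hd2))) as [N1 HN1].
  destruct Hx as [N2 HN2].
  exists (Nat.max N1 N2); intros N HN.
  specialize (HN1 N ltac:(lia)); specialize (HN2 N ltac:(lia)).
  simpl in HN1; rewrite Rminus_0_r in HN1; apply Rabs_def2 in HN1.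
  assert (H1 := Rmin_l d1 d2); assert (H2 := Rmin_r d1 d2).
  specialize (Hup _ HN2); specialize (Hdn _ HN2).
  apply Rabs_def1.
  - destruct (Rle_dec (z + eps) (x N)) as [H|H]; [specialize (Hup H)|]; lra.
  - destruct (Rle_dec (x N) (z - eps)) as [H|H]; [specialize (Hdn H)|]; lra.
Qed.

(** * Roots of the even characteristic equation *)

(** For [p = half_odd_pi k] this is [cos z + z * sin z] at [z = y + p], up to
    the sign [(-1) ^ k] (see [even_char_shift]).  In the variable [y], which
    ranges over [0, PI / 2], it is decreasing, so there is one root for each
    [k]. *)
Definition even_eq (p y : R) : R := (y + p) * cos y - sin y.

Lemma even_eq_derive p y : is_derive (even_eq p) y (- (y + p) * sin y).
Proof. unfold even_eq; auto_derive; [easy|ring]. Qed.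

Lemma even_eq_decreasing p :
  0 < p -> forall s t, 0 <= s -> s < t -> t <= PI / 2 ->
  even_eq p t < even_eq p s.
Proof.
  intros Hp; apply decreasing_of_derive with (fun y => - (y + p) * sin y).
  - intros y _; apply even_eq_derive.
  - intros y Hy; assert (0 < sin y) by (apply sin_gt_0; lra).
    assert (0 < (y + p) * sin y) by (apply Rmult_lt_0_compat; lra); lra.
Qed.

Lemma ivt_decreasing (f : R -> R) (a b : R) :
  a < b -> (forall x, ex_derive f x) -> 0 < f a -> f b < 0 ->
  exists c, a < c < b /\ f c = 0.
Proof.
  intros Hab Hd Ha Hb.
  destruct (IVT (fun x => - f x) a b) as [c [Hc E]]; try lra.
  - intros x; apply continuity_pt_filterlim.
    apply (ex_derive_continuous (fun x => - f x)); auto_derive; apply Hd.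
  - exists c; split; [|lra].
    split; apply Rnot_le_lt; intros H.
    + assert (c = a) by lra; subst; lra.
    + assert (c = b) by lra; subst; lra.
Qed.

Lemma even_eq_root p :
  0 < p -> exists y, 0 < y < PI / 2 /\ even_eq p y = 0.
Proof.
  intros Hp; assert (HPI := PI_RGT_0); apply ivt_decreasing.
  - lra.
  - intros y; eexists; apply even_eq_derive.
  - unfold even_eq; rewrite sin_0, cos_0; lra.
  - unfold even_eq; rewrite sin_PI2, cos_PI2; lra.
Qed.

(** The condition [k <= N] keeps the argument of the scaled sine below [PI],
    so the left side is positive at [y = 0]; at [PI / 2] it is [-1]. *)
Lemma discrete_even_root N k :
  (k <= N)%nat ->
  exists y, 0 < y < PI / 2 /\
    INR (S N) * sin ((y + half_odd_pi k) / INR (S N)) * cos y - sin y = 0.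
Proof.
  intros Hk; assert (HPI := PI_RGT_0); assert (HN := INR_S_pos N).
  apply ivt_decreasing.
  - lra.
  - intros y; auto_derive; lra.
  - rewrite sin_0, cos_0, Rplus_0_l.
    assert (Hk0 := pos_INR k).
    assert (INR k + 1 <= INR (S N)) by (rewrite <- S_INR; apply le_INR; lia).
    assert (0 < sin (half_odd_pi k / INR (S N))); [|nra].
    unfold half_odd_pi; apply sin_gt_0.
    + apply Rdiv_lt_0_compat; nra.
    + apply Rlt_div_l; nra.
  - rewrite sin_PI2, cos_PI2; lra.
Qed.

(** The value of [cos z + z * sin z] at the imaginary point [z = i m]. *)
Definition hyp_eq (m : R) : R := cosh m - m * sinh m.

Lemma is_derive_cosh x : is_derive cosh x (sinh x).
Proof. apply is_derive_Reals, derivable_pt_lim_cosh. Qed.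

Lemma is_derive_sinh x : is_derive sinh x (cosh x).
Proof. apply is_derive_Reals, derivable_pt_lim_sinh. Qed.

Lemma cosh_pos x : 0 < cosh x.
Proof.
  unfold cosh; assert (A := exp_pos x); assert (B := exp_pos (- x)); lra.
Qed.

Lemma hyp_eq_derive m : is_derive hyp_eq m (- m * cosh m).
Proof.
  unfold hyp_eq.
  evar_last.
  - apply (is_derive_minus cosh (fun x => x * sinh x));
      [apply is_derive_cosh|].
    apply (is_derive_mult (fun x => x) sinh);
      [apply is_derive_id|apply is_derive_sinh|intros; apply Rmult_comm].
  - unfold minus, plus, opp, mult, one; simpl; ring.
Qed.

Lemma hyp_eq_decreasing s t : 0 <= s -> s < t -> hyp_eq t < hyp_eq s.
Proof.
  intros Hs Hst.
  apply (decreasing_of_derive hyp_eq (fun m => - m * cosh m) 0 t); try lra.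
  - intros x _; apply hyp_eq_derive.
  - intros x Hx; assert (H := cosh_pos x); nra.
Qed.

Lemma cosh2_lt_sinh2 : cosh 2 < 2 * sinh 2.
Proof.
  unfold cosh, sinh.
  assert (H : 1 + 2 < exp 2) by (apply exp_ineq1; lra).
  assert (H1 : forall x, exp (- x) * exp x = 1)
    by (intros x; rewrite <- exp_plus, Rplus_opp_l; apply exp_0).
  specialize (H1 2); assert (H2 := exp_pos (Ropp 2)); nra.
Qed.

Lemma sinh_ge x : 0 <= x -> x <= sinh x.
Proof.
  intros [Hx | <-]; [|rewrite sinh_0; lra].
  destruct (mvt_open sinh cosh 0 x Hx) as [c [Hc E]].
  - intros t _; apply is_derive_sinh.
  - intros t _; apply derivable_continuous, derivable_sinh.
  - rewrite sinh_0 in E; assert (H := cosh_gt_1 c ltac:(lra)); nra.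
Qed.

Lemma hyp_eq_root : exists m, 0 < m < 2 /\ hyp_eq m = 0.
Proof.
  apply ivt_decreasing.
  - lra.
  - intros y; eexists; apply hyp_eq_derive.
  - unfold hyp_eq; rewrite sinh_0, cosh_0; lra.
  - assert (H := cosh2_lt_sinh2); unfold hyp_eq; lra.
Qed.

(** The interval [0, 2] contains the roots for all [N] because
    [n * sinh (2 / n) >= 2] and [cosh 2 < 2 * sinh 2]. *)
Lemma discrete_hyp_root N :
  exists m, 0 < m < 2 /\
    cosh m - INR (S N) * sinh (m / INR (S N)) * sinh m = 0.
Proof.
  assert (HN := INR_S_pos N).
  apply ivt_decreasing.
  - lra.
  - intros m.
    apply (ex_derive_minus cosh
             (fun x => INR (S N) * sinh (x / INR (S N)) * sinh x)).
    + eexists; apply is_derive_cosh.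
    + apply (ex_derive_mult (fun x => INR (S N) * sinh (x / INR (S N))));
        [|eexists; apply is_derive_sinh].
      apply ex_derive_scal, ex_derive_comp; [eexists; apply is_derive_sinh|].
      auto_derive; lra.
  - rewrite sinh_0, cosh_0; lra.
  - assert (H := cosh2_lt_sinh2).
    assert (H2 : 2 / INR (S N) <= sinh (2 / INR (S N)))
      by (apply sinh_ge; left; apply Rdiv_lt_0_compat; lra).
    assert (H3 : 2 <= INR (S N) * sinh (2 / INR (S N))).
    { replace 2 with (INR (S N) * (2 / INR (S N))) at 1 by (field; lra).
      apply Rmult_le_compat_l; lra. }
    assert (0 < sinh 2) by (rewrite <- sinh_0; apply sinh_lt; lra).
    nra.
Qed.

(** The limit of [sum_inv_even_roots] divided by [n ^ 2].  The exact discrete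
    roots satisfy the limiting equations up to an error that vanishes with
    [1 / n], hence converge to [zeta k] and [mu]. *)
Lemma sum_even_and_hyp (zeta : nat -> R) (mu : R) :
  (forall k, exists y, 0 < y < PI / 2 /\ even_eq (half_odd_pi k) y = 0 /\
     zeta k = y + half_odd_pi k) ->
  0 < mu < 2 -> hyp_eq mu = 0 ->
  is_series (fun k => 2 / zeta k ^ 2) (2 / mu ^ 2 - 1).
Proof.
  intros Hzeta Hmu Hmu0.
  assert (HPI := PI_RGT_0).
  set (y := fun N k => epsilon (inhabits 0) (fun y => 0 < y < PI / 2 /\
    INR (S N) * sin ((y + half_odd_pi k) / INR (S N)) * cos y - sin y = 0)).
  assert (Hy : forall N k, (k <= N)%nat -> 0 < y N k < PI / 2 /\
    INR (S N) * sin ((y N k + half_odd_pi k) / INR (S N)) * cos (y N k)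
      - sin (y N k) = 0).
  { intros N k Hk; unfold y; apply epsilon_spec.
    now apply discrete_even_root. }
  set (m := fun N => epsilon (inhabits 0) (fun m => 0 < m < 2 /\
    cosh m - INR (S N) * sinh (m / INR (S N)) * sinh m = 0)).
  assert (Hm : forall N, 0 < m N < 2 /\
    cosh (m N) - INR (S N) * sinh (m N / INR (S N)) * sinh (m N) = 0).
  { intros N; unfold m; apply epsilon_spec, discrete_hyp_root. }
  clearbody y m.
  assert (Hp := half_odd_pi_pos).
  assert (Hylim : forall k,
    is_lim_seq (fun N => y N k + half_odd_pi k) (zeta k)).
  { intros k; destruct (Hzeta k) as [y0 [Hy0 [Hroot ->]]].
    apply (is_lim_seq_plus' _ _ y0 (half_odd_pi k)); [|apply is_lim_seq_const].
    apply root_convergence with (even_eq (half_odd_pi k)) 0 (PI / 2).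
    - now apply even_eq_decreasing.
    - lra.
    - exact Hroot.
    - exists k; intros N HN; destruct (Hy N k HN); lra.
    - assert (H := is_lim_seq_scaled sin (fun N => y N k + half_odd_pi k)
        (PI / 2 + half_odd_pi k) sin_0 is_derive_sin_0).
      specialize (Hp k).
      assert (H1 : eventually (fun N =>
         Rabs (y N k + half_odd_pi k) <= PI / 2 + half_odd_pi k)).
      { exists k; intros N HN; destruct (Hy N k HN).
        rewrite Rabs_pos_eq; lra. }
      specialize (H H1).
      apply is_lim_seq_abs_0 in H.
      apply is_lim_seq_abs_0.
      apply is_lim_seq_le_le_loc with (fun _ => 0)
        (fun N => Rabs (INR (S N) * sin ((y N k + half_odd_pi k) / INR (S N))
                        - (y N k + half_odd_pi k))).
      + exists k; intros N HN; split; [apply Rabs_pos|].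
        destruct (Hy N k HN) as [_ HyN]; unfold even_eq.
        replace ((y N k + half_odd_pi k) * cos (y N k) - sin (y N k))
          with (- (INR (S N) * sin ((y N k + half_odd_pi k) / INR (S N))
                - (y N k + half_odd_pi k)) * cos (y N k)) by lra.
        rewrite Rabs_mult, Rabs_Ropp.
        rewrite <- (Rmult_1_r (Rabs (_ - _))) at 2.
        apply Rmult_le_compat_l; [apply Rabs_pos|].
        apply Rabs_le, COS_bound.
      + apply is_lim_seq_const.
      + exact H. }
  assert (Hmlim : is_lim_seq m mu).
  { apply root_convergence with hyp_eq 0 2.
    - intros s t Hs Hst _; now apply hyp_eq_decreasing.
    - lra.
    - exact Hmu0.
    - exists 0%nat; intros N _; destruct (Hm N); lra.
    - assert (H1 : eventually (fun N => Rabs (m N) <= 2)).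
      { exists 0%nat; intros N _; destruct (Hm N).
        rewrite Rabs_pos_eq; lra. }
      assert (H := is_lim_seq_scaled sinh m 2 sinh_0 is_derive_sinh_0 H1).
      apply is_lim_seq_abs_0 in H.
      apply is_lim_seq_abs_0.
      assert (H2 := is_lim_seq_mult' _ _ _ _ H (is_lim_seq_const (sinh 2))).
      rewrite Rmult_0_l in H2.
      apply is_lim_seq_le_le with (3 := H2) (u := fun _ => 0);
        [|apply is_lim_seq_const].
      intros N; split; [apply Rabs_pos|].
      destruct (Hm N) as [HmN HmN0]; unfold hyp_eq.
      replace (cosh (m N) - m N * sinh (m N))
        with ((INR (S N) * sinh (m N / INR (S N)) - m N) * sinh (m N)) by lra.
      rewrite Rabs_mult; apply Rmult_le_compat_l; [apply Rabs_pos|].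
      assert (sinh 0 < sinh (m N)) by (apply sinh_lt; lra).
      assert (sinh (m N) < sinh 2) by (apply sinh_lt; lra).
      rewrite sinh_0 in *; rewrite Rabs_pos_eq; lra. }
  destruct (sum_inv_cos_limit (fun N k => y N k + half_odd_pi k) zeta)
    as [Hex Hlim].
  { intros N k Hk; destruct (Hy N k Hk); lra. }
  { exact Hylim. }
  assert (Hc := is_lim_seq_scaled_cosh m mu Hmlim).
  apply is_lim_seq_inv in Hc; [|intros E; injection E; nra].
  assert (Hsum := is_lim_seq_plus' _ _ _ (/ (- (mu ^ 2 / 2))) Hlim Hc).
  replace (2 / mu ^ 2 - 1) with (Series (fun k => 2 / zeta k ^ 2)).
  { now apply Series_correct. }
  apply is_lim_seq_unique in Hsum.
  rewrite (Lim_seq_ext _ (fun _ => - 1)), Lim_seq_const in Hsum.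
  - assert (E : - 1 = Series (fun k => 2 / zeta k ^ 2) + / - (mu ^ 2 / 2))
      by (injection Hsum as E; exact E).
    replace (/ - (mu ^ 2 / 2)) with (- (2 / mu ^ 2)) in E by (field; lra).
    lra.
  - intros N; assert (HN := INR_S_pos N); destruct (Hm N) as [HmN HmN0].
    assert (E : sum_n (fun k =>
        / (1 - cos ((y N k + half_odd_pi k) / INR (S N)))) N
        + / (1 - cosh (m N / INR (S N))) = - INR (S N) ^ 2).
    { apply (sum_inv_even_roots N (fun k => y N k + half_odd_pi k)).
      - intros k Hk; destruct (Hy N k Hk).
        destruct (half_odd_pi_bounds k); lra.
      - intros k Hk; destruct (Hy N k Hk) as [_ E].
        rewrite cos_half_odd_pi, sin_half_odd_pi.
        transitivity ((-1) ^ k * (INR (S N) *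
           sin ((y N k + half_odd_pi k) / INR (S N)) * cos (y N k)
           - sin (y N k))); [ring|rewrite E; ring].
      - lra.
      - exact HmN0. }
    assert (H1 : 1 < cosh (m N / INR (S N)))
      by (apply cosh_gt_1, Rdiv_lt_0_compat; lra).
    rewrite Rinv_mult.
    transitivity ((sum_n (fun k =>
        / (1 - cos ((y N k + half_odd_pi k) / INR (S N)))) N
        + / (1 - cosh (m N / INR (S N)))) / INR (S N) ^ 2).
    + field; lra.
    + rewrite E; field; lra.
Qed.

(** * Calculus on the closed unit interval *)

Definition unit_nbhd (x : R) : (R -> Prop) -> Prop :=
  within (fun y => 0 <= y <= 1) (locally x).

Definition continuous_unit (f : R -> R) : Prop :=
  forall x, 0 <= x <= 1 -> filterlim f (unit_nbhd x) (locally (f x)).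

Definition derive_unit (f : R -> R) (x l : R) : Prop :=
  filterdiff (K := R_AbsRing) (U := R_NormedModule) (V := R_NormedModule)
    f (unit_nbhd x) (fun h => scal h l).

Lemma is_filter_lim_unit x : is_filter_lim (unit_nbhd x) x.
Proof. intros P HP; unfold unit_nbhd, within; now apply filter_imp with P. Qed.

Lemma unit_nbhd_lim_unique x y :
  0 <= x <= 1 -> is_filter_lim (unit_nbhd x) y -> x = y.
Proof.
  intros Hx Hy.
  destruct (Req_dec x y) as [E|Hxy]; [exact E|exfalso].
  assert (Hd : 0 < Rabs (x - y)) by (apply Rabs_pos_lt; lra).
  destruct (Hy (fun t => Rabs (t - y) < Rabs (x - y))) as [d Hd'].
  { exists (mkposreal _ Hd); intros t Ht; exact Ht. }
  specialize (Hd' x (ball_center x d) Hx); lra.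
Qed.

Lemma locally_open_unit x : 0 < x < 1 -> locally x (fun t => 0 < t < 1).
Proof.
  intros [H0 H1]; apply filter_and; [now apply (open_gt 0)|now apply (open_lt 1)].
Qed.

Lemma derive_unit_interior f x l :
  0 < x < 1 -> derive_unit f x l -> is_derive f x l.
Proof.
  intros Hx [Hlin Hdom]; split; [exact Hlin|].
  intros y Hy eps.
  rewrite <- (is_filter_lim_locally_unique x y Hy).
  specialize (Hdom x (is_filter_lim_unit x) eps).
  unfold unit_nbhd, within in Hdom.
  assert (Hin : locally x (fun t => 0 <= t <= 1)).
  { apply filter_imp with (fun t => 0 < t < 1); [intros; lra|].
    now apply locally_open_unit. }
  assert (H := filter_and _ _ Hin Hdom).
  now apply filter_imp with (2 := H); intros t [H1 H2]; apply H2.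
Qed.

Lemma is_derive_unit_of_is_derive (f : R -> C) x (l : C) :
  0 <= x <= 1 ->
  is_derive (K := R_AbsRing) (V := C_R_NormedModule) f x l ->
  is_derive_unit f x l.
Proof.
  intros Hx [Hlin Hdom]; split; [exact Hlin|].
  intros y Hy eps.
  rewrite <- (unit_nbhd_lim_unique x y Hx Hy).
  specialize (Hdom x (fun P HP => HP) eps).
  unfold within; now apply filter_imp with (2 := Hdom).
Qed.

Lemma derive_unit_continuous f df :
  (forall x, 0 <= x <= 1 -> derive_unit f x (df x)) -> continuous_unit f.
Proof.
  intros Hf x Hx.
  apply (filterdiff_continuous_aux (K := R_AbsRing) (U := R_NormedModule)
           (V := R_NormedModule) f).
  - exists (fun h => scal h (df x)); now apply Hf.
  - apply is_filter_lim_unit.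
Qed.

Lemma continuous_unit_mult f g :
  continuous_unit f -> continuous_unit g ->
  continuous_unit (fun x => f x * g x).
Proof.
  intros Hf Hg x Hx.
  apply (filterlim_comp_2 (G := locally (f x)) (H := locally (g x))
           f g Rmult); auto.
  apply (filterlim_mult (K := R_AbsRing)).
Qed.

Lemma continuous_unit_minus f g :
  continuous_unit f -> continuous_unit g ->
  continuous_unit (fun x => f x - g x).
Proof.
  intros Hf Hg x Hx.
  apply (filterlim_comp_2 (G := locally (f x)) (H := locally (- g x))
           f (fun x => - g x) Rplus); auto.
  - eapply filterlim_comp; [now apply Hg|].
    apply (filterlim_opp (V := R_NormedModule)).
  - apply (filterlim_plus (V := R_NormedModule)).
Qed.

Lemma continuous_unit_plus f g :
  continuous_unit f -> continuous_unit g ->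
  continuous_unit (fun x => f x + g x).
Proof.
  intros Hf Hg x Hx.
  apply (filterlim_comp_2 (G := locally (f x)) (H := locally (g x))
           f g Rplus); auto.
  apply (filterlim_plus (V := R_NormedModule)).
Qed.

Lemma continuous_unit_of_continuous (f : R -> R) :
  (forall x, continuous f x) -> continuous_unit f.
Proof.
  intros Hf x _; apply filterlim_filter_le_1 with (2 := Hf x).
  apply filter_le_within.
Qed.

(** The retraction of the line onto the unit interval.  Composing with it
    turns one-sided continuity at the endpoints into continuity on the line, so
    that the usual mean value theorem applies. *)
Definition clamp (x : R) : R := Rmax 0 (Rmin x 1).

Lemma clamp_range x : 0 <= clamp x <= 1.
Proof. unfold clamp, Rmax, Rmin; repeat destruct Rle_dec; lra. Qed.

Lemma clamp_id x : 0 <= x <= 1 -> clamp x = x.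
Proof. intros Hx; unfold clamp, Rmax, Rmin; repeat destruct Rle_dec; lra. Qed.

Lemma clamp_contract x y : Rabs (clamp y - clamp x) <= Rabs (y - x).
Proof.
  unfold clamp, Rmax, Rmin, Rabs; repeat destruct Rle_dec;
    repeat destruct Rcase_abs; lra.
Qed.

Lemma continuous_clamp f x :
  continuous_unit f -> continuous (fun t => f (clamp t)) x.
Proof.
  intros Hf; unfold continuous.
  eapply filterlim_comp; [|apply Hf, clamp_range].
  intros P [d Hd]; exists d; intros y Hy.
  apply Hd; [|apply clamp_range].
  apply Rle_lt_trans with (1 := clamp_contract x y); exact Hy.
Qed.

Lemma mvt_unit f df a b :
  continuous_unit f -> (forall x, 0 < x < 1 -> is_derive f x (df x)) ->
  0 <= a -> a < b -> b <= 1 ->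
  exists c, a < c < b /\ f b - f a = df c * (b - a).
Proof.
  intros Hc Hd Ha Hab Hb.
  destruct (mvt_open (fun t => f (clamp t)) df a b Hab) as [c [Hcab E]].
  - intros x Hx.
    apply is_derive_ext_loc with f; [|apply Hd; lra].
    apply filter_imp with (fun t => 0 < t < 1).
    + intros t Ht; rewrite clamp_id by lra; reflexivity.
    + apply locally_open_unit; lra.
  - intros x _; apply continuity_pt_filterlim.
    now apply (continuous_clamp f x).
  - exists c; split; [exact Hcab|].
    now rewrite !clamp_id in E by lra.
Qed.

Lemma continuous_unit_bounded f :
  continuous_unit f ->
  exists M, forall x, 0 <= x <= 1 -> Rabs (f x) <= M.
Proof.
  intros Hf.
  destruct (bounded_continuity (K := R_AbsRing) (V := R_NormedModule)
              (fun t => f (clamp t)) 0 1) as [M HM].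
  - intros x _; now apply (continuous_clamp f x).
  - exists M; intros x Hx; left; rewrite <- (clamp_id x Hx) at 1; now apply HM.
Qed.

Lemma constant_unit f :
  continuous_unit f -> (forall x, 0 < x < 1 -> is_derive f x 0) ->
  forall x, 0 <= x <= 1 -> f x = f 0.
Proof.
  intros Hc Hd x [[Hx0 | <-] Hx1]; [|reflexivity].
  destruct (mvt_unit f (fun _ => 0) 0 x) as [c [_ E]]; auto; lra.
Qed.

Lemma derive_unit_eps f x l :
  derive_unit f x l -> forall eps, 0 < eps ->
  exists d, 0 < d /\ forall y, 0 <= y <= 1 -> Rabs (y - x) < d ->
    Rabs (f y - f x - (y - x) * l) <= eps * Rabs (y - x).
Proof.
  intros [_ Hdom] eps Heps.
  destruct (Hdom x (is_filter_lim_unit x) (mkposreal _ Heps)) as [d Hd].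
  exists d; split; [apply cond_pos|]; intros y Hy Hyx.
  exact (Hd y Hyx Hy).
Qed.

(** A derivative need not be continuous at an endpoint where it is one-sided;
    here it is, because the second derivative is bounded.  Close to [x] the
    chord slopes of [u] tend to [du x], and by the mean value theorem each of
    them is a value of [du] at a point [c] no further from [y] than [x] is,
    which differs from [du y] by at most [M * Rabs (y - x)]. *)
Lemma derivative_lipschitz_at u du ddu M :
  (forall x, 0 <= x <= 1 -> derive_unit u x (du x)) ->
  (forall x, 0 < x < 1 -> is_derive du x (ddu x)) ->
  (forall x, 0 < x < 1 -> Rabs (ddu x) <= M) ->
  forall x y, 0 <= x <= 1 -> 0 < y < 1 ->
    Rabs (du y - du x) <= M * Rabs (y - x).
Proof.
  intros Hu Hdu HM x y Hx Hy.
  assert (Hlip : forall s, 0 < s < 1 -> Rabs (du s - du y) <= M * Rabs (s - y)).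
  { intros s Hs.
    destruct (MVT_gen du s y ddu) as [c [Hc E]].
    - intros t Ht; apply Hdu.
      revert Ht; unfold Rmin, Rmax; destruct Rle_dec; lra.
    - intros t Ht; apply continuity_pt_filterlim, (ex_derive_continuous du).
      exists (ddu t); apply Hdu.
      revert Ht; unfold Rmin, Rmax; destruct Rle_dec; lra.
    - rewrite Rabs_minus_sym, E, Rabs_mult, (Rabs_minus_sym s).
      apply Rmult_le_compat_r; [apply Rabs_pos|]; apply HM.
      revert Hc; unfold Rmin, Rmax; destruct Rle_dec; lra. }
  destruct (Req_dec x y) as [<-|Hxy].
  { rewrite !Rminus_diag, Rabs_R0; lra. }
  assert (HM0 : 0 <= M) by
    (apply Rle_trans with (2 := HM y Hy); apply Rabs_pos).
  assert (Hcu := derive_unit_continuous u du Hu).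
  apply le_epsilon; intros eps Heps.
  destruct (derive_unit_eps u x (du x) (Hu x Hx) eps Heps) as [d [Hd Hdx]].
  assert (Hyx : 0 < Rabs (y - x)) by (apply Rabs_pos_lt; lra).
  (* The chord from x to t = x + tau (y - x) is short enough for the difference
     quotient at x to be within eps of du x. *)
  set (tau := Rmin 1 (d / (2 * Rabs (y - x)))).
  assert (Ht0 : 0 < tau).
  { apply Rmin_pos; [lra|]; apply Rdiv_lt_0_compat; lra. }
  assert (Ht1 : tau <= 1) by apply Rmin_l.
  assert (Htd : tau * Rabs (y - x) < d).
  { apply Rle_lt_trans with (d / (2 * Rabs (y - x)) * Rabs (y - x)).
    - apply Rmult_le_compat_r; [lra|apply Rmin_r].
    - replace (d / (2 * Rabs (y - x)) * Rabs (y - x)) with (d / 2)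
        by (field; lra); lra. }
  clearbody tau.
  set (t := x + tau * (y - x)).
  assert (Ht : 0 <= t <= 1) by (unfold t; nra).
  assert (Htx : t - x = tau * (y - x)) by (unfold t; ring).
  assert (Htx' : Rabs (t - x) = tau * Rabs (y - x))
    by (rewrite Htx, Rabs_mult, (Rabs_pos_eq tau); lra).
  specialize (Hdx t Ht ltac:(lra)).
  assert (Hmv : exists c, 0 < c < 1 /\ Rabs (c - y) <= Rabs (y - x) /\
            u t - u x = du c * (t - x)).
  { assert (Hdu0 : forall s, 0 < s < 1 -> is_derive u s (du s))
      by (intros s Hs; apply derive_unit_interior, Hu; lra).
    destruct (Rdichotomy x y Hxy) as [H|H].
    - destruct (mvt_unit u du x t Hcu Hdu0) as [c [Hc E]];
        [lra|unfold t; nra|lra|].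
      assert (Hty : t <= y) by (unfold t; nra).
      exists c; split; [lra|]; split; [|exact E].
      rewrite Rabs_minus_sym, !Rabs_pos_eq; lra.
    - destruct (mvt_unit u du t x Hcu Hdu0) as [c [Hc E]];
        [lra|unfold t; nra|lra|].
      assert (Hty : y <= t) by (unfold t; nra).
      exists c; split; [lra|]; split; [|lra].
      rewrite (Rabs_minus_sym y), !Rabs_pos_eq; lra. }
  destruct Hmv as [c [Hc [Hcy E]]].
  specialize (Hlip c Hc).
  rewrite E in Hdx.
  replace (du c * (t - x) - (t - x) * du x) with ((du c - du x) * (t - x))
    in Hdx by ring.
  rewrite Rabs_mult in Hdx.
  apply Rmult_le_reg_r in Hdx; [|rewrite Htx'; nra].
  replace (du y - du x) with (- (du c - du y) + (du c - du x)) by ring.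
  eapply Rle_trans; [apply Rabs_triang|]; rewrite Rabs_Ropp.
  assert (M * Rabs (c - y) <= M * Rabs (y - x))
    by now apply Rmult_le_compat_l.
  lra.
Qed.

Lemma derivative_continuous_unit u du ddu M :
  (forall x, 0 <= x <= 1 -> derive_unit u x (du x)) ->
  (forall x, 0 < x < 1 -> is_derive du x (ddu x)) ->
  (forall x, 0 < x < 1 -> Rabs (ddu x) <= M) ->
  continuous_unit du.
Proof.
  intros Hu Hdu HM.
  assert (Hlip := derivative_lipschitz_at u du ddu M Hu Hdu HM).
  intros x Hx.
  assert (HM0 : 0 <= M) by
    (apply Rle_trans with (2 := HM (1 / 2) ltac:(lra)); apply Rabs_pos).
  intros P [eps HP]; unfold filtermap, unit_nbhd, within.
  assert (Heps := cond_pos eps).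
  assert (Hd : 0 < Rmin 1 (eps / (M + 1))).
  { apply Rmin_pos; [lra|]; apply Rdiv_lt_0_compat; lra. }
  exists (mkposreal _ Hd); intros y Hy Hy01; apply HP.
  change (Rabs (du y - du x) < eps).
  change (Rabs (y - x) < Rmin 1 (eps / (M + 1))) in Hy.
  assert (Hy1 := Rlt_le_trans _ _ _ Hy (Rmin_l _ _)).
  assert (Hy2 := Rlt_le_trans _ _ _ Hy (Rmin_r _ _)).
  apply Rlt_div_r in Hy2; [|lra].
  assert (H0 := Rabs_pos (y - x)).
  destruct (Req_dec x y) as [<-|Hxy].
  { rewrite Rminus_diag, Rabs_R0; lra. }
  assert (Hint : 0 < x < 1 \/ 0 < y < 1).
  { revert Hy1; unfold Rabs; destruct Rcase_abs; intros; lra. }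
  destruct Hint as [Hint|Hint].
  - specialize (Hlip y x Hy01 Hint).
    rewrite Rabs_minus_sym, (Rabs_minus_sym x) in Hlip; nra.
  - specialize (Hlip x y Hx Hint); nra.
Qed.

Lemma is_derive_Rmult (f g : R -> R) x (a b : R) :
  is_derive f x a -> is_derive g x b ->
  is_derive (fun t => f t * g t) x (a * g x + f x * b).
Proof.
  intros Hf Hg.
  apply (is_derive_mult f g x a b Hf Hg); intros; apply Rmult_comm.
Qed.

(** * Reality of eigenvalues and the characteristic equation *)

Lemma filterdiff_Re F {FF : Filter F} (f : R -> C) (l : C) :
  filterdiff (K := R_AbsRing) (U := R_NormedModule) (V := C_R_NormedModule)
    f F (fun h => scal h (l : C_R_NormedModule)) ->
  filterdiff (K := R_AbsRing) (U := R_NormedModule) (V := R_NormedModule)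
    (fun t => Re (f t)) F (fun h => scal h (Re l)).
Proof.
  intros H.
  exact (filterdiff_comp (K := R_AbsRing) (U := R_NormedModule)
    (V := C_R_NormedModule) (W := R_NormedModule) f Re _ _ H
    (filterdiff_linear (K := R_AbsRing) (U := C_R_NormedModule)
       (V := R_NormedModule) Re
       (is_linear_fst (U := R_NormedModule) (V := R_NormedModule)))).
Qed.

Lemma filterdiff_Im F {FF : Filter F} (f : R -> C) (l : C) :
  filterdiff (K := R_AbsRing) (U := R_NormedModule) (V := C_R_NormedModule)
    f F (fun h => scal h (l : C_R_NormedModule)) ->
  filterdiff (K := R_AbsRing) (U := R_NormedModule) (V := R_NormedModule)
    (fun t => Im (f t)) F (fun h => scal h (Im l)).
Proof.
  intros H.
  exact (filterdiff_comp (K := R_AbsRing) (U := R_NormedModule)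
    (V := C_R_NormedModule) (W := R_NormedModule) f Im _ _ H
    (filterdiff_linear (K := R_AbsRing) (U := C_R_NormedModule)
       (V := R_NormedModule) Im
       (is_linear_snd (U := R_NormedModule) (V := R_NormedModule)))).
Qed.

Lemma is_linear_RtoC :
  is_linear (K := R_AbsRing) (U := R_NormedModule) (V := C_R_NormedModule) RtoC.
Proof.
  apply (is_linear_prod (K := R_AbsRing) (T := R_NormedModule)
    (U := R_NormedModule) (V := R_NormedModule) (fun x => x) (fun _ => 0)).
  - apply is_linear_id.
  - apply (is_linear_zero (U := R_NormedModule) (V := R_NormedModule)).
Qed.

Lemma is_derive_RtoC (f : R -> R) x l :
  is_derive f x l ->
  is_derive (K := R_AbsRing) (V := C_R_NormedModule)
    (fun t => RtoC (f t)) x (RtoC l).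
Proof.
  intros H.
  assert (H1 := filterdiff_comp (K := R_AbsRing) (U := R_NormedModule)
    (V := R_NormedModule) (W := C_R_NormedModule) f RtoC _ _ H
    (filterdiff_linear (K := R_AbsRing) (U := R_NormedModule)
       (V := C_R_NormedModule) RtoC is_linear_RtoC)).
  apply filterdiff_ext_lin with (1 := H1).
  intros y; unfold RtoC, scal; simpl; unfold prod_scal, scal; simpl.
  f_equal; unfold mult; simpl; ring.
Qed.

Lemma bvp_components (lam : C) phi dphi :
  is_bvp_solution lam phi dphi ->
  let u x := Re (phi x) in let v x := Im (phi x) in
  let du x := Re (dphi x) in let dv x := Im (dphi x) in
  (forall x, 0 <= x <= 1 -> derive_unit u x (du x) /\ derive_unit v x (dv x)) /\
  (forall x, 0 < x < 1 ->
     is_derive du x (- (Re lam * u x - Im lam * v x)) /\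
     is_derive dv x (- (Re lam * v x + Im lam * u x))) /\
  (u 0 + u 1 = - du 0 /\ v 0 + v 1 = - dv 0) /\
  (- du 0 = du 1 /\ - dv 0 = dv 1).
Proof.
  intros [Hphi [Hdphi [Hb1 Hb2]]] u v du dv.
  split; [|split; [|split]].
  - intros x Hx; specialize (Hphi x Hx); split.
    + now apply (filterdiff_Re (unit_nbhd x)).
    + now apply (filterdiff_Im (unit_nbhd x)).
  - intros x Hx; destruct (Hdphi x Hx) as [d2 [Hd2 E]]; split.
    + replace (- (Re lam * u x - Im lam * v x)) with (Re d2).
      * now apply (filterdiff_Re (locally x)).
      * assert (E' := f_equal Re E); simpl in E'.
        unfold u, v, Re, Im in *; simpl in E'; lra.
    + replace (- (Re lam * v x + Im lam * u x)) with (Im d2).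
      * now apply (filterdiff_Im (locally x)).
      * assert (E' := f_equal Im E); simpl in E'.
        unfold u, v, Re, Im in *; simpl in E'; lra.
  - exact (conj (f_equal Re Hb1) (f_equal Im Hb1)).
  - exact (conj (f_equal Re Hb2) (f_equal Im Hb2)).
Qed.

Lemma zero_unit f :
  continuous_unit f -> (forall x, 0 < x < 1 -> f x = 0) ->
  forall x, 0 <= x <= 1 -> f x = 0.
Proof.
  intros Hf H0.
  assert (Hd : forall x, 0 < x < 1 -> is_derive f x 0).
  { intros x Hx; apply is_derive_ext_loc with (fun _ => 0).
    - apply filter_imp with (2 := locally_open_unit x Hx).
      intros t Ht; now rewrite H0.
    - apply (is_derive_const 0). }
  assert (H := constant_unit f Hf Hd).
  intros x Hx; rewrite (H x Hx), <- (H (1 / 2)) by lra.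
  apply H0; lra.
Qed.

(** Let [W = u * dv - v * du] be the Wronskian of the real and imaginary
    parts.  Its derivative is [- b * (u ^ 2 + v ^ 2)] with [b = Im lam], and the
    boundary conditions give [W 0 = W 1].  If [b] is not zero then [b * W] is
    monotone with equal end values, hence constant, so [u] and [v] vanish. *)
Lemma eigenvalue_real (lam : C) : is_eigenvalue lam -> Im lam = 0.
Proof.
  intros [phi [dphi [Hbvp [x0 [Hx0 Hphi0]]]]].
  destruct (bvp_components lam phi dphi Hbvp) as [Hd [Hdd [[B1 B2] [B3 B4]]]].
  set (u := fun x => Re (phi x)) in *; set (v := fun x => Im (phi x)) in *.
  set (du := fun x => Re (dphi x)) in *; set (dv := fun x => Im (dphi x)) in *.
  set (a := Re lam) in *; set (b := Im lam) in *.
  change (forall x, 0 < x < 1 ->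
    is_derive du x (- (a * u x - b * v x)) /\
    is_derive dv x (- (a * v x + b * u x))) in Hdd.
  change (u 0 + u 1 = - du 0) in B1; change (v 0 + v 1 = - dv 0) in B2.
  change (- du 0 = du 1) in B3; change (- dv 0 = dv 1) in B4.
  assert (Hu : forall x, 0 <= x <= 1 -> derive_unit u x (du x))
    by (intros x Hx; now apply Hd).
  assert (Hv : forall x, 0 <= x <= 1 -> derive_unit v x (dv x))
    by (intros x Hx; now apply Hd).
  assert (Cu := derive_unit_continuous u du Hu).
  assert (Cv := derive_unit_continuous v dv Hv).
  destruct (continuous_unit_bounded u Cu) as [Mu HMu].
  destruct (continuous_unit_bounded v Cv) as [Mv HMv].
  assert (Hbound : forall s t x, 0 < x < 1 ->
     Rabs (- (s * u x + t * v x)) <= Rabs s * Mu + Rabs t * Mv).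
  { intros s t x Hx; rewrite Rabs_Ropp.
    eapply Rle_trans; [apply Rabs_triang|]; rewrite !Rabs_mult.
    apply Rplus_le_compat; apply Rmult_le_compat_l; try apply Rabs_pos;
      [apply HMu|apply HMv]; lra. }
  assert (Cdu : continuous_unit du).
  { apply (derivative_continuous_unit u du _ (Rabs a * Mu + Rabs (- b) * Mv)
             Hu (fun x Hx => proj1 (Hdd x Hx))).
    intros x Hx; replace (a * u x - b * v x) with (a * u x + - b * v x) by ring.
    now apply Hbound. }
  assert (Cdv : continuous_unit dv).
  { apply (derivative_continuous_unit v dv _ (Rabs b * Mu + Rabs a * Mv)
             Hv (fun x Hx => proj2 (Hdd x Hx))).
    intros x Hx; replace (a * v x + b * u x) with (b * u x + a * v x) by ring.
    now apply Hbound. }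
  set (W := fun x => u x * dv x - v x * du x).
  assert (CW : continuous_unit W).
  { apply continuous_unit_minus; now apply continuous_unit_mult. }
  assert (HW : forall x, 0 < x < 1 ->
            is_derive W x (- b * (u x ^ 2 + v x ^ 2))).
  { intros x Hx; destruct (Hdd x Hx) as [Hdu Hdv].
    assert (Hu' := derive_unit_interior _ _ _ Hx (Hu x ltac:(lra))).
    assert (Hv' := derive_unit_interior _ _ _ Hx (Hv x ltac:(lra))).
    evar_last.
    - apply (is_derive_minus (fun x => u x * dv x) (fun x => v x * du x));
        apply is_derive_Rmult; eassumption.
    - unfold minus, plus, opp; simpl; ring. }
  assert (HW01 : W 1 = W 0) by (unfold W; rewrite <- B3, <- B4; nra).
  apply NNPP; intros Hb.
  assert (Hmono : forall x y, 0 <= x -> x < y -> y <= 1 ->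
            b * W y <= b * W x).
  { intros x y Hx Hxy Hy.
    destruct (mvt_unit W _ x y CW HW) as [c [Hc E]]; try lra.
    assert (0 <= (b * b * (u c ^ 2 + v c ^ 2)) * (y - x)) by
      (apply Rmult_le_pos; [apply Rmult_le_pos|]; nra).
    assert (b * W y - b * W x = - (b * b * (u c ^ 2 + v c ^ 2) * (y - x)))
      by (rewrite <- Rmult_minus_distr_l, E; ring).
    lra. }
  assert (Hconst : forall x, 0 < x < 1 -> W x = W 0).
  { intros x Hx.
    assert (H1 := Hmono 0 x); assert (H2 := Hmono x 1).
    rewrite HW01 in H2.
    apply (Rmult_eq_reg_l b); [lra|exact Hb]. }
  assert (Hzero : forall x, 0 < x < 1 -> u x = 0 /\ v x = 0).
  { intros x Hx.
    assert (HD : is_derive W x 0).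
    { apply is_derive_ext_loc with (fun _ => W 0).
      - apply filter_imp with (2 := locally_open_unit x Hx).
        intros t Ht; symmetry; now apply Hconst.
      - apply (is_derive_const (W 0)). }
    assert (E := is_derive_unique _ _ _ (HW x Hx)).
    rewrite (is_derive_unique _ _ _ HD) in E.
    symmetry in E; apply Rmult_integral in E; destruct E as [E|E]; [lra|].
    split; nra. }
  apply Hphi0.
  assert (Eu := zero_unit u Cu (fun x Hx => proj1 (Hzero x Hx)) x0 Hx0).
  assert (Ev := zero_unit v Cv (fun x Hx => proj2 (Hzero x Hx)) x0 Hx0).
  unfold u, v, Re, Im in Eu, Ev; rewrite (surjective_pairing (phi x0)).
  now rewrite Eu, Ev.
Qed.

(** The solutions [c] and [s] of [f'' = - a f] that are even with [c 0 = 1]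
    and odd with [s' 0 = 1]: the functions cos (sqrt a t) and
    sin (sqrt a t) / sqrt a, in a form that covers every sign of [a]. *)
Definition fundamental_pair (a : R) (c s : R -> R) : Prop :=
  (forall t : R, is_derive c t (- a * s t)) /\
  (forall t : R, is_derive s t (c t)) /\
  c 0 = 1 /\ (forall t, c (- t) = c t) /\ (forall t, s (- t) = - s t) /\
  (forall t, c t ^ 2 + a * s t ^ 2 = 1).

(** The two alternatives are the boundary conditions for the odd solution
    [s (x - / 2)] and for the even solution [c (x - / 2)]. *)
Definition characteristic (a : R) (c s : R -> R) : Prop :=
  c (/ 2) = 0 \/ 2 * c (/ 2) + a * s (/ 2) = 0.

Lemma is_derive_centered (f : R -> R) (l x : R) :
  is_derive f (x - / 2) l -> is_derive (fun t => f (t - / 2)) x l.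
Proof.
  intros Hf; evar_last.
  - apply (is_derive_comp f (fun t => t - / 2) x l 1 Hf).
    auto_derive; [easy|ring].
  - unfold scal; simpl; unfold mult; simpl; ring.
Qed.

(** The coordinates [A] and [B] of [(u, du)] in the fundamental system
    centred at [/ 2] are constant.  In terms of them the boundary conditions
    read [B * c (/ 2) = 0] and, once [B = 0],
    [A * (2 * c (/ 2) + a * s (/ 2)) = 0]. *)
Lemma real_bvp_characteristic a c s (u du : R -> R) x0 :
  fundamental_pair a c s ->
  (forall x, 0 <= x <= 1 -> derive_unit u x (du x)) ->
  (forall x, 0 < x < 1 -> is_derive du x (- (a * u x))) ->
  u 0 + u 1 = - du 0 -> - du 0 = du 1 ->
  0 <= x0 <= 1 -> u x0 <> 0 ->
  characteristic a c s.
Proof.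
  intros [Hc [Hs [Hc0 [Hceven [Hsodd Hcs]]]]] Hu Hdu B1 B2 Hx0 Hux0.
  assert (Cu := derive_unit_continuous u du Hu).
  assert (Cdu : continuous_unit du).
  { destruct (continuous_unit_bounded u Cu) as [Mu HMu].
    apply (derivative_continuous_unit u du _ (Rabs a * Mu) Hu Hdu).
    intros x Hx; rewrite Rabs_Ropp, Rabs_mult.
    apply Rmult_le_compat_l; [apply Rabs_pos|apply HMu; lra]. }
  set (c' := fun x => c (x - / 2)); set (s' := fun x => s (x - / 2)).
  assert (Hc' : forall x, is_derive c' x (- a * s' x))
    by (intros x; now apply is_derive_centered).
  assert (Hs' : forall x, is_derive s' x (c' x))
    by (intros x; now apply is_derive_centered).
  assert (Cc : continuous_unit c').
  { apply continuous_unit_of_continuous; intros x.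
    apply (ex_derive_continuous c'); eexists; apply Hc'. }
  assert (Cs : continuous_unit s').
  { apply continuous_unit_of_continuous; intros x.
    apply (ex_derive_continuous s'); eexists; apply Hs'. }
  set (A := fun x => u x * c' x - du x * s' x).
  set (B := fun x => u x * (a * s' x) + du x * c' x).
  assert (HA : forall x, 0 <= x <= 1 -> A x = A 0).
  { apply constant_unit.
    - apply continuous_unit_minus; now apply continuous_unit_mult.
    - intros x Hx.
      assert (Hu' := derive_unit_interior _ _ _ Hx (Hu x ltac:(lra))).
      evar_last.
      + apply (is_derive_minus (fun x => u x * c' x) (fun x => du x * s' x));
          apply is_derive_Rmult; eauto.
      + unfold minus, plus, opp; simpl; ring. }
  assert (HB : forall x, 0 <= x <= 1 -> B x = B 0).
  { apply constant_unit.
    - apply continuous_unit_plus; apply continuous_unit_mult; auto.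
      apply (continuous_unit_mult (fun _ => a)); auto.
      apply continuous_unit_of_continuous; intros x; apply continuous_const.
    - intros x Hx.
      assert (Hu' := derive_unit_interior _ _ _ Hx (Hu x ltac:(lra))).
      evar_last.
      + apply (is_derive_plus (fun x => u x * (a * s' x)) (fun x => du x * c' x));
          apply is_derive_Rmult; eauto.
        apply is_derive_scal; auto.
      + unfold minus, plus, opp; simpl; ring. }
  assert (Eu : forall x, 0 <= x <= 1 -> u x = A 0 * c' x + B 0 * s' x).
  { intros x Hx; rewrite <- (HA x Hx), <- (HB x Hx); unfold A, B.
    assert (E : c' x ^ 2 + a * s' x ^ 2 = 1) by apply Hcs.
    transitivity (u x * (c' x ^ 2 + a * s' x ^ 2)); [rewrite E|]; ring. }
  assert (Edu : forall x, 0 <= x <= 1 -> du x = - a * A 0 * s' x + B 0 * c' x).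
  { intros x Hx; rewrite <- (HA x Hx), <- (HB x Hx); unfold A, B.
    assert (E : c' x ^ 2 + a * s' x ^ 2 = 1) by apply Hcs.
    transitivity (du x * (c' x ^ 2 + a * s' x ^ 2)); [rewrite E|]; ring. }
  assert (c'0 : c' 0 = c (/ 2)).
  { unfold c'; rewrite Rminus_0_l; apply Hceven. }
  assert (s'0 : s' 0 = - s (/ 2)).
  { unfold s'; rewrite Rminus_0_l; apply Hsodd. }
  assert (c'1 : c' 1 = c (/ 2)) by (unfold c'; f_equal; lra).
  assert (s'1 : s' 1 = s (/ 2)) by (unfold s'; f_equal; lra).
  rewrite (Eu 0), (Eu 1), (Edu 0) in B1 by lra.
  rewrite (Edu 0), (Edu 1) in B2 by lra.
  rewrite c'0, c'1, s'0, s'1 in *.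
  set (ch := c (/ 2)) in *; set (sh := s (/ 2)) in *.
  assert (HBc : B 0 * ch = 0) by lra.
  destruct (Rmult_integral _ _ HBc) as [HB0|Hch]; [right|now left].
  assert (HAc : A 0 * (2 * ch + a * sh) = 0) by (rewrite HB0 in *; lra).
  destruct (Rmult_integral _ _ HAc) as [HA0|H]; [|exact H].
  exfalso; apply Hux0; rewrite (Eu x0 Hx0), HA0, HB0; ring.
Qed.

Lemma eigenvalue_of_real_solution a (u du : R -> R) x0 :
  (forall x : R, is_derive u x (du x)) ->
  (forall x : R, is_derive du x (- a * u x)) ->
  u 0 + u 1 = - du 0 -> - du 0 = du 1 ->
  0 <= x0 <= 1 -> u x0 <> 0 -> is_eigenvalue (RtoC a).
Proof.
  intros Hu Hdu B1 B2 Hx0 Hux0.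
  exists (fun x => RtoC (u x)), (fun x => RtoC (du x)); split.
  - split; [|split; [|split]].
    + intros x Hx; apply is_derive_unit_of_is_derive; [exact Hx|].
      now apply is_derive_RtoC.
    + intros x _; exists (RtoC (- a * u x)); split.
      * now apply is_derive_RtoC.
      * rewrite <- RtoC_opp, <- RtoC_mult; f_equal; ring.
    + now rewrite <- RtoC_plus, <- RtoC_opp, B1.
    + now rewrite <- RtoC_opp, B2.
  - exists x0; split; [exact Hx0|]; intros E; now injection E.
Qed.

Lemma eigenvalue_iff_characteristic a c s :
  fundamental_pair a c s ->
  is_eigenvalue (RtoC a) <-> characteristic a c s.
Proof.
  intros Hpair; split.
  - intros [phi [dphi [Hbvp [x0 [Hx0 Hphi0]]]]].
    destruct (bvp_components _ phi dphi Hbvp) as [Hd [Hdd [[B1 B2] [B3 B4]]]].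
    cbn [Re Im fst snd RtoC] in *.
    destruct (Req_dec (Re (phi x0)) 0) as [Hr|Hr].
    + apply (real_bvp_characteristic a c s (fun x => Im (phi x))
        (fun x => Im (dphi x)) x0 Hpair); auto.
      * intros x Hx; now apply Hd.
      * intros x Hx; destruct (Hdd x Hx) as [_ H].
        replace (a * _) with (a * Im (phi x) + 0 * Re (phi x)) by ring.
        exact H.
      * intros Hi; apply Hphi0; unfold Re, Im in *.
        rewrite (surjective_pairing (phi x0)); now rewrite Hr, Hi.
    + apply (real_bvp_characteristic a c s (fun x => Re (phi x))
        (fun x => Re (dphi x)) x0 Hpair); auto.
      * intros x Hx; now apply Hd.
      * intros x Hx; destruct (Hdd x Hx) as [H _].
        replace (a * _) with (a * Re (phi x) - 0 * Im (phi x)) by ring.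
        exact H.
  - destruct Hpair as [Hc [Hs [Hc0 [Hceven [Hsodd Hcs]]]]].
    assert (H1 : 1 - / 2 = / 2) by lra.
    intros [H|H].
    + apply (eigenvalue_of_real_solution a (fun x => s (x - / 2))
        (fun x => c (x - / 2)) 1).
      * intros x; now apply is_derive_centered.
      * intros x; apply is_derive_centered, Hc.
      * rewrite Rminus_0_l, Hceven, Hsodd, H1, H; ring.
      * rewrite Rminus_0_l, Hceven, H1, H; ring.
      * lra.
      * rewrite H1; intros E; assert (E1 := Hcs (/ 2)).
        rewrite H, E in E1; lra.
    + apply (eigenvalue_of_real_solution a (fun x => c (x - / 2))
        (fun x => - a * s (x - / 2)) (/ 2)).
      * intros x; now apply is_derive_centered.
      * intros x; apply is_derive_scal, is_derive_centered, Hs.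
      * rewrite Rminus_0_l, Hceven, Hsodd, H1; lra.
      * rewrite Rminus_0_l, Hsodd, H1; ring.
      * lra.
      * rewrite Rminus_diag, Hc0; lra.
Qed.

(** * The spectrum *)

Lemma fundamental_pair_trig z :
  0 < z ->
  fundamental_pair (4 * z ^ 2) (fun t => cos (2 * z * t))
    (fun t => sin (2 * z * t) / (2 * z)).
Proof.
  intros Hz; repeat apply conj.
  - intros t; auto_derive; [easy|field; lra].
  - intros t; auto_derive; [easy|field; lra].
  - rewrite Rmult_0_r; apply cos_0.
  - intros t; rewrite <- cos_neg; f_equal; ring.
  - intros t; replace (2 * z * - t) with (- (2 * z * t)) by ring.
    rewrite sin_neg; field; lra.
  - intros t; assert (H := sin2_cos2 (2 * z * t)); unfold Rsqr in H.
    rewrite <- H; field; lra.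
Qed.

Lemma cosh_even x : cosh (- x) = cosh x.
Proof. unfold cosh; rewrite Ropp_involutive; field. Qed.

Lemma sinh_odd x : sinh (- x) = - sinh x.
Proof. unfold sinh; rewrite Ropp_involutive; field. Qed.

Lemma fundamental_pair_hyp m :
  0 < m ->
  fundamental_pair (- (4 * m ^ 2)) (fun t => cosh (2 * m * t))
    (fun t => sinh (2 * m * t) / (2 * m)).
Proof.
  intros Hm; repeat apply conj.
  - intros t; evar_last.
    + apply (is_derive_comp cosh (fun t => 2 * m * t)); [apply is_derive_cosh|].
      auto_derive; [easy|reflexivity].
    + unfold scal; simpl; unfold mult; simpl; field; lra.
  - intros t; evar_last.
    + unfold Rdiv; apply (is_derive_mult (fun t => sinh (2 * m * t))
                            (fun _ => / (2 * m))).
      * apply (is_derive_comp sinh (fun t => 2 * m * t)); [apply is_derive_sinh|].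
        auto_derive; [easy|reflexivity].
      * apply is_derive_const.
      * intros; apply Rmult_comm.
    + unfold scal, plus, zero; simpl; unfold mult; simpl; field; lra.
  - rewrite Rmult_0_r; apply cosh_0.
  - intros t; rewrite <- cosh_even; f_equal; ring.
  - intros t; replace (2 * m * - t) with (- (2 * m * t)) by ring.
    rewrite sinh_odd; field; lra.
  - intros t; rewrite <- (cosh2_sinh2 (2 * m * t)); field; lra.
Qed.

Lemma fundamental_pair_zero : fundamental_pair 0 (fun _ => 1) (fun t => t).
Proof.
  repeat apply conj; intros; try ring.
  - auto_derive; [easy|ring].
  - auto_derive; [easy|ring].
Qed.

Lemma eigenvalue_trig z :
  0 < z ->
  is_eigenvalue (RtoC (4 * z ^ 2)) <->
  cos z = 0 \/ cos z + z * sin z = 0.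
Proof.
  intros Hz.
  rewrite (eigenvalue_iff_characteristic _ _ _ (fundamental_pair_trig z Hz)).
  unfold characteristic.
  replace (2 * z * / 2) with z by field.
  replace (2 * cos z + 4 * z ^ 2 * (sin z / (2 * z)))
    with (2 * (cos z + z * sin z)) by (field; lra).
  split; intros [H|H]; [now left|right; lra|now left|right; lra].
Qed.

Lemma eigenvalue_hyp m :
  0 < m -> is_eigenvalue (RtoC (- (4 * m ^ 2))) <-> hyp_eq m = 0.
Proof.
  intros Hm.
  rewrite (eigenvalue_iff_characteristic _ _ _ (fundamental_pair_hyp m Hm)).
  unfold characteristic, hyp_eq.
  replace (2 * m * / 2) with m by field.
  replace (2 * cosh m + - (4 * m ^ 2) * (sinh m / (2 * m)))
    with (2 * (cosh m - m * sinh m)) by (field; lra).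
  assert (H := cosh_pos m).
  split; [intros [H0|H0]|intros H0; right]; lra.
Qed.

Lemma eigenvalue_not_zero : ~ is_eigenvalue (RtoC 0).
Proof.
  rewrite (eigenvalue_iff_characteristic _ _ _ fundamental_pair_zero).
  unfold characteristic; lra.
Qed.

Lemma hyp_eq_unique m m' :
  0 <= m -> 0 <= m' -> hyp_eq m = 0 -> hyp_eq m' = 0 -> m = m'.
Proof.
  intros Hm Hm' E E'.
  destruct (Rtotal_order m m') as [H|[H|H]]; [|exact H|].
  - assert (H1 := hyp_eq_decreasing m m' Hm H); lra.
  - assert (H1 := hyp_eq_decreasing m' m Hm' H); lra.
Qed.

Lemma even_eq_unique p y y' :
  0 < p -> 0 <= y <= PI / 2 -> 0 <= y' <= PI / 2 ->
  even_eq p y = 0 -> even_eq p y' = 0 -> y = y'.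
Proof.
  intros Hp Hy Hy' E E'.
  destruct (Rtotal_order y y') as [H|[H|H]]; [|exact H|].
  - assert (H1 := even_eq_decreasing p Hp y y'); lra.
  - assert (H1 := even_eq_decreasing p Hp y' y); lra.
Qed.

Lemma pow_m1_neq k : (-1) ^ k <> 0.
Proof. apply pow_nonzero; lra. Qed.

Lemma even_char_shift k y :
  cos (y + half_odd_pi k) + (y + half_odd_pi k) * sin (y + half_odd_pi k)
  = (-1) ^ k * even_eq (half_odd_pi k) y.
Proof. rewrite cos_half_odd_pi, sin_half_odd_pi; unfold even_eq; ring. Qed.

Lemma pi_decomposition z :
  0 < z -> exists k x, 0 <= x < PI /\ z = x + INR k * PI.
Proof.
  intros Hz; assert (HPI := PI_RGT_0).
  destruct (nfloor_ex (z / PI)) as [k [Hk1 Hk2]].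
  { left; now apply Rdiv_lt_0_compat. }
  exists k, (z - INR k * PI).
  apply Rle_div_r in Hk1; [|exact HPI].
  apply Rlt_div_l in Hk2; [|exact HPI].
  split; [split|]; lra.
Qed.

Lemma cos_zero_half_odd_pi z :
  0 < z -> cos z = 0 -> exists k, z = half_odd_pi k.
Proof.
  intros Hz Hcos.
  destruct (pi_decomposition z Hz) as [k [x [Hx ->]]].
  rewrite cos_shift_pi in Hcos.
  apply Rmult_integral in Hcos; destruct Hcos as [H|H].
  { now apply pow_m1_neq in H. }
  exists k; unfold half_odd_pi.
  replace x with (PI / 2); [field|].
  apply cos_inj; [lra|lra|]; now rewrite cos_PI2.
Qed.

(** Where [cos] and [sin] have the same sign the left side cannot vanish,
    so all the positive roots lie in the second halves of the intervals
    [[k PI, (k + 1) PI]]. *)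
Lemma even_char_root z :
  0 < z -> cos z + z * sin z = 0 ->
  exists k y, 0 <= y <= PI / 2 /\ even_eq (half_odd_pi k) y = 0 /\
    z = y + half_odd_pi k.
Proof.
  intros Hz Hroot.
  destruct (pi_decomposition z Hz) as [k [x [Hx E]]].
  destruct (Rle_or_lt (PI / 2) x) as [Hx2|Hx2].
  - exists k, (x - PI / 2); split; [lra|].
    assert (Ez : z = x - PI / 2 + half_odd_pi k)
      by (rewrite E; unfold half_odd_pi; field).
    split; [|exact Ez].
    rewrite Ez, even_char_shift in Hroot.
    apply Rmult_integral in Hroot; destruct Hroot as [H|H]; [|exact H].
    now apply pow_m1_neq in H.
  - exfalso; rewrite E in Hroot at 1 3.
    rewrite cos_shift_pi, sin_shift_pi in Hroot.
    assert (H : (-1) ^ k * (cos x + z * sin x) = 0) by lra.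
    apply Rmult_integral in H; destruct H as [H|H].
    { now apply pow_m1_neq in H. }
    assert (0 < cos x) by (apply cos_gt_0; lra).
    assert (0 <= sin x) by (apply sin_ge_0; lra).
    nra.
Qed.

(** * Summation in an arbitrary order *)

Lemma sum_n_single i0 (c : R) n :
  sum_n (fun i => if (i =? i0)%nat then c else 0) n =
  if (i0 <=? n)%nat then c else 0.
Proof.
  induction n as [|n IH].
  - rewrite sum_O; now destruct i0.
  - rewrite sum_Sn, IH.
    destruct (Nat.leb_spec i0 n), (Nat.eqb_spec (S n) i0),
      (Nat.leb_spec i0 (S n)); try lia;
      first [apply Rplus_0_r | apply Rplus_0_l].
Qed.

Lemma is_series_single i0 (c : R) :
  is_series (fun i => if (i =? i0)%nat then c else 0) c.
Proof.
  apply (is_lim_seq_ext_loc (fun _ => c) _ c); [|apply is_lim_seq_const].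
  exists i0; intros n Hn.
  now rewrite sum_n_single, (proj2 (Nat.leb_le i0 n) Hn).
Qed.

(** The terms of the sequence [r] that belong to the family [f] add up to the
    sum over the family, in whatever order [r] lists them: the partial sums
    over [i <= n] are sums over [k] of the terms reached so far, and each term
    is reached eventually. *)
Lemma is_series_reindex (r f : nat -> R) (g : R -> R) :
  (forall i j, r i = r j -> i = j) -> (forall i j, f i = f j -> i = j) ->
  (forall k, exists i, r i = f k) -> ex_series (fun k => Rabs (g (f k))) ->
  is_series (fun i => if excluded_middle_informative (exists k, f k = r i)
                      then g (r i) else 0)
    (Series (fun k => g (f k))).
Proof.
  intros Hr Hf Hrf Hex.
  set (term := fun i => if excluded_middle_informative (exists k, f k = r i)
                        then g (r i) else 0).
  set (delta := fun i k => if Req_EM_T (r i) (f k) then g (f k) else 0).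
  (* delta i k is the k-th term of the family when position i lists it. *)
  set (a := fun n k => sum_n (fun i => delta i k) n).
  assert (Hdelta : forall i, is_series (delta i) (term i)).
  { intros i; unfold term.
    destruct (excluded_middle_informative _) as [[k0 Hk0]|Hno].
    - apply is_series_ext with (2 := is_series_single k0 (g (r i))).
      intros k; unfold delta.
      destruct (Nat.eqb_spec k k0) as [->|Hk], (Req_EM_T _ _) as [E|E];
        congruence || (exfalso; apply Hk, Hf; congruence).
    - apply is_series_ext with (2 := is_series_single 0 0).
      intros k; unfold delta.
      destruct (Req_EM_T _ _) as [E|E]; [|now destruct (k =? 0)%nat].
      exfalso; apply Hno; now exists k. }
  assert (Ha : forall n, is_series (a n) (sum_n term n)).
  { induction n as [|n IH].
    - rewrite sum_O; apply is_series_ext with (2 := Hdelta 0%nat).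
      intros k; unfold a; now rewrite sum_O.
    - rewrite sum_Sn.
      apply is_series_ext with (2 := is_series_plus _ _ _ _ IH (Hdelta (S n))).
      intros k; unfold a; now rewrite sum_Sn. }
  assert (Hak : forall k, exists i0, forall n,
             a n k = if (i0 <=? n)%nat then g (f k) else 0).
  { intros k; destruct (Hrf k) as [i0 Hi0]; exists i0; intros n.
    rewrite <- sum_n_single; apply sum_n_ext; intros i; unfold delta.
    destruct (Nat.eqb_spec i i0) as [->|Hi], (Req_EM_T _ _) as [E|E];
      congruence || (exfalso; apply Hi, Hr; congruence). }
  apply (is_lim_seq_ext (fun n => Series (a n)) _
           (Series (fun k => g (f k)))).
  { intros n; apply is_series_unique, Ha. }
  apply tannery with (fun k => Rabs (g (f k))); [| |exact Hex].
  - intros n k; destruct (Hak k) as [i0 Hi0]; rewrite Hi0.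
    destruct (i0 <=? n)%nat; [lra|rewrite Rabs_R0; apply Rabs_pos].
  - intros k; destruct (Hak k) as [i0 Hi0].
    apply (is_lim_seq_ext_loc (fun _ => g (f k)) _ (g (f k)));
      [|apply is_lim_seq_const].
    exists i0; intros n Hn; now rewrite Hi0, (proj2 (Nat.leb_le i0 n) Hn).
Qed.

Lemma half_odd_pi_block_inj i j y y' :
  0 <= y < PI -> 0 <= y' < PI ->
  y + half_odd_pi i = y' + half_odd_pi j -> i = j.
Proof.
  intros Hy Hy' E; unfold half_odd_pi in E.
  assert (HPI := PI_RGT_0).
  destruct (Nat.lt_total i j) as [H|[H|H]]; [|exact H|]; exfalso;
    apply le_INR in H; rewrite S_INR in H; nra.
Qed.

Lemma is_series_RtoC (a : nat -> R) (l : R) :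
  is_series a l ->
  is_series (K := R_AbsRing) (V := C_R_NormedModule)
    (fun n => RtoC (a n)) (RtoC l).
Proof.
  intros Ha.
  assert (Hc := linear_cont (K := R_AbsRing) (U := R_NormedModule)
    (V := C_R_NormedModule) RtoC l is_linear_RtoC).
  assert (H := filterlim_comp _ _ _ _ _ _ _ _ Ha Hc).
  apply filterlim_ext with (2 := H); intros n.
  induction n as [|n IH]; [now rewrite !sum_O|].
  rewrite !sum_Sn, <- IH; apply RtoC_plus.
Qed.

(** [od] collects the eigenvalues with eigenfunctions odd about 1/2, and [ev]
    those with even eigenfunctions, the negative eigenvalue first. *)
Lemma eigenvalue_families :
  exists od ev : nat -> R,
    ((forall i j, od i = od j -> i = j) /\ (forall i j, ev i = ev j -> i = j) /\
     (forall i j, od i <> ev j)) /\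
    (forall a, is_eigenvalue (RtoC a) <->
       (exists k, od k = a) \/ (exists k, ev k = a)) /\
    (is_series (fun k => / od k) (/ 8) /\ is_series (fun k => / ev k) (- / 8)) /\
    (ex_series (fun k => Rabs (/ od k)) /\ ex_series (fun k => Rabs (/ ev k))).
Proof.
  assert (HPI := PI_RGT_0).
  destruct hyp_eq_root as [mu [Hmu Hmu0]].
  set (y := fun k => epsilon (inhabits 0)
              (fun y => 0 < y < PI / 2 /\ even_eq (half_odd_pi k) y = 0)).
  assert (Hy : forall k, 0 < y k < PI / 2 /\ even_eq (half_odd_pi k) (y k) = 0).
  { intros k; unfold y; apply epsilon_spec, even_eq_root, half_odd_pi_pos. }
  clearbody y.
  set (zeta := fun k => y k + half_odd_pi k).
  assert (Hzeta : forall k, 0 < zeta k).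
  { intros k; unfold zeta; assert (H := half_odd_pi_pos k).
    destruct (Hy k); lra. }
  set (od := fun k => 4 * half_odd_pi k ^ 2).
  set (ev := fun k => match k with
                      | O => - (4 * mu ^ 2)
                      | S k => 4 * zeta k ^ 2
                      end).
  assert (Hodd : is_series (fun k => / od k) (/ 8)).
  { assert (H := is_series_scal_l (/ 8) _ _ is_series_half_odd_pi).
    rewrite Rmult_1_r in H; apply is_series_ext with (2 := H).
    intros k; assert (H1 := half_odd_pi_pos k).
    change (/ 8 * (2 / half_odd_pi k ^ 2) = / (4 * half_odd_pi k ^ 2)).
    field; lra. }
  assert (Hev : is_series (fun k => / ev k) (- / 8)).
  { apply is_series_decr_1.
    assert (H : is_series (fun k => 2 / zeta k ^ 2) (2 / mu ^ 2 - 1)).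
    { apply sum_even_and_hyp; auto; intros k; exists (y k).
      destruct (Hy k); auto. }
    apply (is_series_scal_l (/ 8)) in H.
    evar_last.
    - apply is_series_ext with (2 := H).
      intros k; assert (H1 := Hzeta k).
      change (/ 8 * (2 / zeta k ^ 2) = / (4 * zeta k ^ 2)); field; lra.
    - change (/ 8 * (2 / mu ^ 2 - 1) = - / 8 + - / - (4 * mu ^ 2)).
      field; lra. }
  assert (Hsq : forall s t, 0 < s -> 0 < t -> 4 * s ^ 2 = 4 * t ^ 2 -> s = t).
  { intros s t Hs Ht E; nra. }
  assert (Hzchar : forall k, cos (zeta k) + zeta k * sin (zeta k) = 0).
  { intros k; unfold zeta; rewrite even_char_shift, (proj2 (Hy k)); ring. }
  assert (Hod_eig : forall k, is_eigenvalue (RtoC (od k))).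
  { intros k; apply (eigenvalue_trig _ (half_odd_pi_pos k)); left.
    rewrite <- (Rplus_0_l (half_odd_pi k)), cos_half_odd_pi, sin_0; ring. }
  assert (Hev_eig : forall k, is_eigenvalue (RtoC (ev k))).
  { intros [|k]; [now apply eigenvalue_hyp|].
    apply (eigenvalue_trig _ (Hzeta k)); now right. }
  assert (Hod_inj : forall i j, od i = od j -> i = j).
  { intros i j E; apply Hsq in E; try apply half_odd_pi_pos.
    apply (half_odd_pi_block_inj i j 0 0); lra. }
  assert (Hev_inj : forall i j, ev i = ev j -> i = j).
  { intros [|i] [|j] E; simpl ev in E; [reflexivity| | |f_equal].
    - assert (H := Hzeta j); nra.
    - assert (H := Hzeta i); nra.
    - apply Hsq in E; auto.
      destruct (Hy i), (Hy j).
      apply (half_odd_pi_block_inj i j (y i) (y j)); auto; lra. }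
  assert (Hdisj : forall i j, od i <> ev j).
  { intros i [|j] E; unfold od in E; simpl ev in E;
      assert (H := half_odd_pi_pos i); [nra|].
    apply Hsq in E; auto.
    assert (Hc := Hzchar j); rewrite <- E in Hc.
    rewrite <- (Rplus_0_l (half_odd_pi i)), even_char_shift in Hc.
    unfold even_eq in Hc; rewrite cos_0, sin_0 in Hc.
    assert (H1 := pow_m1_neq i); apply H1.
    apply (Rmult_eq_reg_r (half_odd_pi i)); lra. }
  assert (Hcover : forall a, is_eigenvalue (RtoC a) ->
            (exists k, od k = a) \/ (exists k, ev k = a)).
  { intros a Ha; destruct (Rtotal_order a 0) as [H|[H|H]].
    - right; exists 0%nat; simpl.
      assert (Hs := sqrt_lt_R0 (- a) ltac:(lra)).
      assert (Hs2 := sqrt_sqrt (- a) ltac:(lra)).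
      replace a with (- (4 * (sqrt (- a) / 2) ^ 2)) in Ha |- * by (simpl; lra).
      apply eigenvalue_hyp in Ha; [|lra].
      rewrite (hyp_eq_unique mu (sqrt (- a) / 2)); auto; lra.
    - subst a; now apply eigenvalue_not_zero in Ha.
    - assert (Hs := sqrt_lt_R0 a H).
      assert (Hs2 := sqrt_sqrt a ltac:(lra)).
      assert (Ea : a = 4 * (sqrt a / 2) ^ 2) by (simpl; lra).
      rewrite Ea in Ha; apply eigenvalue_trig in Ha; [|lra].
      destruct Ha as [Ha|Ha].
      + left; destruct (cos_zero_half_odd_pi (sqrt a / 2)) as [k Hk]; [lra|auto|].
        exists k; unfold od; rewrite <- Hk; now symmetry.
      + right; destruct (even_char_root (sqrt a / 2)) as [k [x [Hx [Hx0 Hk]]]];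
          [lra|auto|].
        exists (S k); simpl ev; destruct (Hy k) as [Hyk Hyk0].
        unfold zeta; rewrite (even_eq_unique (half_odd_pi k) (y k) x); auto;
          [|apply half_odd_pi_pos|lra].
        rewrite <- Hk; now symmetry. }
  assert (Hod_abs : ex_series (fun k => Rabs (/ od k))).
  { exists (/ 8); apply is_series_ext with (2 := Hodd).
    intros k; rewrite Rabs_pos_eq; [reflexivity|].
    left; apply Rinv_0_lt_compat; unfold od.
    assert (H := half_odd_pi_pos k); nra. }
  assert (Hev_abs : ex_series (fun k => Rabs (/ ev k))).
  { apply ex_series_incr_1.
    assert (H : ex_series (fun k => / ev (S k)))
      by (apply (ex_series_incr_1 (fun k => / ev k)); now exists (- / 8)).
    apply ex_series_ext with (2 := H).
    intros k; rewrite Rabs_pos_eq; [reflexivity|].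
    left; apply Rinv_0_lt_compat; simpl ev.
    assert (H1 := Hzeta k); nra. }
  exists od, ev; split; [|split; [|split]]; auto.
  intros a; split; [apply Hcover|].
  intros [[k <-]|[k <-]]; auto.
Qed.

Theorem theorem1 (lambda : nat -> C) (Hlambda : enumerates_eigenvalues lambda) :
  is_series (K := R_AbsRing) (V := C_R_NormedModule)
    (fun n : nat => (/ lambda n)%C) (RtoC (RInt (fun x : R => K x x) 0 1)) /\
  RInt (fun x : R => K x x) 0 1 = 0.
Proof.
  destruct Hlambda as [Hinj Hspec].
  assert (HK : RInt (fun x : R => K x x) 0 1 = 0).
  { rewrite (RInt_ext _ (fun _ => 0)).
    - rewrite RInt_const; apply Rmult_0_r.
    - intros x _; unfold K; rewrite Rminus_diag, Rabs_R0, Ropp_0.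
      apply Rmult_0_l. }
  split; [|exact HK]; rewrite HK.
  destruct eigenvalue_families as
    [od [ev [[Hod_inj [Hev_inj Hdisj]] [Hclass [[Hodd Hev] [Hod_abs Hev_abs]]]]]].
  set (r := fun n => Re (lambda n)).
  assert (Hr : forall n, lambda n = RtoC (r n)).
  { intros n; assert (H := eigenvalue_real (lambda n)
      (proj2 (Hspec _) (ex_intro _ n eq_refl))).
    unfold r, RtoC; rewrite <- H; apply surjective_pairing. }
  assert (Hr_eig : forall n, is_eigenvalue (RtoC (r n))).
  { intros n; rewrite <- Hr; apply Hspec; now exists n. }
  assert (Hr_onto : forall a, is_eigenvalue (RtoC a) -> exists n, r n = a).
  { intros a Ha; apply Hspec in Ha; destruct Ha as [n Hn]; exists n.
    unfold r; now rewrite Hn. }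
  assert (Hr_inj : forall i j, r i = r j -> i = j).
  { intros i j E; apply Hinj; now rewrite !Hr, E. }
  assert (H1 := is_series_reindex r od Rinv Hr_inj Hod_inj
    (fun k => Hr_onto _ (proj2 (Hclass _)
       (or_introl (ex_intro _ k eq_refl)))) Hod_abs).
  assert (H2 := is_series_reindex r ev Rinv Hr_inj Hev_inj
    (fun k => Hr_onto _ (proj2 (Hclass _)
       (or_intror (ex_intro _ k eq_refl)))) Hev_abs).
  rewrite (is_series_unique _ _ Hodd) in H1.
  rewrite (is_series_unique _ _ Hev) in H2.
  assert (H := is_series_plus _ _ _ _ H1 H2).
  assert (Hsum : is_series (fun n => / r n) 0).
  { evar_last.
    - apply is_series_ext with (2 := H); intros n.
      destruct (excluded_middle_informative (exists k, od k = r n)) as [[i Hi]|Ho],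
        (excluded_middle_informative (exists k, ev k = r n)) as [[j Hj]|He];
        unfold plus; simpl.
      + exfalso; apply (Hdisj i j); congruence.
      + ring.
      + ring.
      + exfalso; destruct (proj1 (Hclass _) (Hr_eig n)); auto.
    - unfold plus; simpl; lra. }
  apply is_series_RtoC in Hsum.
  apply is_series_ext with (2 := Hsum); intros n.
  rewrite Hr; apply RtoC_inv; intros E.
  apply eigenvalue_not_zero; rewrite <- E; apply Hr_eig.
Qed.
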